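(* Let $K$ be a field, let $E$ be a $K$-vector space of infinite rank (infinite dimension), and let $R=K\propto E$ be the trivial ring extension of $K$ by $E$. Then: (1) $R$ is a $G$-$(2,0)$-ring. (2) $R$ is not a $G$-$(1,d)$-ring, for every positive integer $d$. (3) Let $S$ be a Noetherian commutative ring with $\mathrm{G\text{-}gldim}(S)=d$ for an integer $d\ge 0$. Then $T=R\times S$ is a $G$-$(2,d)$-ring, but it is neither a $G$-$(1,d)$-ring nor (when $d\ge 1$) a $G$-$(2,d-1)$-ring.
   Context: All rings are commutative with identity and all modules are unital. For a ring $A$ and an $A$-module $E$, the trivial ring extension $A\propto E$ is the ring with underlying group $A\times E$ and multiplication $(a,e)(a',e')=(aa',ae'+a'e)$. An $R$-module $M$ is Gorenstein projective if there is an exact sequence of projective modules $\mathbf P=\cdots\to P_1\to P_0\to P^0\to P^1\to\cdots$ with $M\cong \mathrm{Im}(P_0\to P^0)$ such that $\mathrm{Hom}_R(-,Q)$ leaves $\mathbf P$ exact for every projective module $Q$. $\mathrm{Gpd}_R(M)$ is the minimal length of a resolution of $M$ by Gorenstein projective modules ($\infty$ if there is no finite one), and $\mathrm{G\text{-}gldim}(R)=\sup\{\mathrm{Gpd}_R(M)\mid M \text{ an } R\text{-module}\}$. For an integer $n\ge 0$, an $R$-module $M$ is $n$-presented if there is an exact sequence $F_n\to F_{n-1}\to\cdots\to F_0\to M\to 0$ with each $F_i$ a finitely generated free $R$-module. For integers $n,d\ge 0$, $R$ is a $G$-$(n,d)$-ring if every $n$-presented $R$-module $M$ satisfies $\mathrm{Gpd}_R(M)\le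 d$. *)

(* Defs.v *)
From HB Require Import structures.
From mathcomp Require Import all_boot all_order all_algebra.
From mathcomp Require Import boolp.

Set Implicit Arguments.
Unset Strict Implicit.
Unset Printing Implicit Defensive.

Import GRing.Theory.
Local Open Scope ring_scope.

(* Rings are [comPzRingType]: the zero ring is allowed. *)

Definition trivext (A : comPzRingType) (E : lmodType A) : Type := (A * E)%type.

Section TrivialExtension.
Variables (A : comPzRingType) (E : lmodType A).

HB.instance Definition _ := GRing.Zmodule.on (trivext E).

Definition trivext_one : trivext E := (1, 0).
Definition trivext_mul (x y : trivext E) : trivext E :=
  (x.1 * y.1, x.1 *: y.2 + y.1 *: x.2).

Fact trivext_mulA : associative trivext_mul.
Proof.
move=> [a e] [b f] [c g]; congr (_, _) => /=; first by rewrite mulrA.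
by rewrite !scalerDr !scalerA addrA (mulrC c a) (mulrC c b).
Qed.

Fact trivext_mulC : commutative trivext_mul.
Proof. by move=> [a e] [b f]; congr (_, _) => /=; rewrite (mulrC, addrC). Qed.

Fact trivext_mul1 : left_id trivext_one trivext_mul.
Proof. by move=> [a e]; congr (_, _) => /=; rewrite ?mul1r // scale1r scaler0 addr0. Qed.

Fact trivext_mulDl : left_distributive trivext_mul +%R.
Proof.
move=> [a e] [b f] [c g]; congr (_, _) => /=; first by rewrite mulrDl.
by rewrite scalerDl scalerDr addrACA.
Qed.

HB.instance Definition _ := GRing.Zmodule_isComPzRing.Build (trivext E)
  trivext_mulA trivext_mulC trivext_mul1 trivext_mulDl.

End TrivialExtension.

(* For modules over a nonzero ring this is "free and finitely generated". *)
Definition fg_free (R : comPzRingType) (F : lmodType R) : Prop :=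
  exists (n : nat) (b : 'I_n -> F),
    forall x : F, exists! c : 'rV[R]_n, x = \sum_i c 0 i *: b i.

Definition infinite_dim (K : fieldType) (E : lmodType K) : Prop := ~ fg_free E.

Definition surj (T U : Type) (f : T -> U) : Prop := forall y, exists x, f x = y.

Definition exact_at (R : comPzRingType) (A B C : lmodType R)
    (f : {linear A -> B}) (g : {linear B -> C}) : Prop :=
  forall x : B, g x = 0 <-> exists y : A, f y = x.

Definition projective (R : comPzRingType) (P : lmodType R) : Prop :=
  forall (A B : lmodType R) (g : {linear A -> B}) (f : {linear P -> B}),
    surj g -> exists h : {linear P -> A}, forall x, g (h x) = f x.

(* Exactness at Hom(B, Q) of Hom(C, Q) -> Hom(B, Q) -> Hom(A, Q). *)
Definition hom_exact_at (R : comPzRingType) (A B C Q : lmodType R)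
    (f : {linear A -> B}) (g : {linear B -> C}) : Prop :=
  forall u : {linear B -> Q},
    (forall x, u (f x) = 0) <->
    exists v : {linear C -> Q}, forall y, v (g y) = u y.

(* The complex ... -> P_1 -> P_0 -> P^0 -> P^1 -> ... is indexed by the
   integers: [P i] is P^i for 0 <= i and [P (- i - 1)] is P_i, so that
   P_0 -> P^0 is [d (-1)], with codomain [P (-1 + 1)], convertible to [P 0].
   The isomorphism of M with Im(P_0 -> P^0) is given as an embedding [e] of M
   in P^0 that has this image. *)
Definition gorenstein_projective (R : comPzRingType) (M : lmodType R) : Prop :=
  exists (P : int -> lmodType R) (d : forall i : int, {linear P i -> P (i + 1)})
         (e : {linear M -> P (-1 + 1)}),
  [/\ forall i, projective (P i),
      forall i, exact_at (d i) (d (i + 1)),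
      forall (Q : lmodType R), projective Q ->
        forall i, hom_exact_at Q (d i) (d (i + 1)),
      injective e
    & forall x, (exists m, e m = x) <-> (exists y, d (-1) y = x)].

(* A resolution 0 -> G_n -> ... -> G_0 -> M -> 0, continued by zero modules. *)
Definition has_gproj_resolution (R : comPzRingType) (M : lmodType R) (n : nat)
    : Prop :=
  exists (G : nat -> lmodType R) (d : forall i : nat, {linear G i.+1 -> G i})
         (eps : {linear G 0%N -> M}),
  [/\ forall i, (i <= n)%N -> gorenstein_projective (G i),
      forall i, (n < i)%N -> forall x : G i, x = 0,
      surj eps,
      exact_at (d 0%N) eps
    & forall i, exact_at (d i.+1) (d i)].

(* Extended natural numbers are [option nat], with [None] for infinity. *)
Definition enat_le (x y : option nat) : Prop :=
  match x, y with
  | _, None => True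
  | None, Some _ => False
  | Some m, Some n => (m <= n)%N
  end.

Definition least (P : nat -> Prop) : option nat :=
  match pselect (exists n, `[< P n >]) with
  | left exP => Some (ex_minn exP)
  | right _ => None
  end.

Lemma least_SomeP (P : nat -> Prop) (n : nat) :
  least P = Some n <-> P n /\ (forall m, P m -> (n <= m)%N).
Proof.
rewrite /least; case: pselect => [exP | nexP]; last first.
  by split=> // -[Pn _]; case: nexP; exists n; apply/asboolP.
case: ex_minnP => k /asboolP Pk mink; split=> [[<-] | [Pn minn]].
  by split=> // m Pm; apply: mink; apply/asboolP.
by congr Some; apply/eqP; rewrite eqn_leq minn // mink //; exact/asboolP.
Qed.

Lemma least_NoneP (P : nat -> Prop) : least P = None <-> forall n, ~ P n.
Proof.
rewrite /least; case: pselect => [[n Pn] | nexP]; split=> //.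
  by move=> /(_ n) nPn; case: nPn; apply/asboolP.
by move=> _ n Pn; apply: nexP; exists n; apply/asboolP.
Qed.

Definition Gpd (R : comPzRingType) (M : lmodType R) : option nat :=
  least (has_gproj_resolution M).

(* The supremum in the extended natural numbers, as the least upper bound. *)
Definition Ggldim (R : comPzRingType) : option nat :=
  least (fun n => forall M : lmodType R, enat_le (Gpd M) (Some n)).

(* The modules F_i with i > n are irrelevant. *)
Definition n_presented (n : nat) (R : comPzRingType) (M : lmodType R) : Prop :=
  exists (F : nat -> lmodType R) (d : forall i : nat, {linear F i.+1 -> F i})
         (eps : {linear F 0%N -> M}),
  [/\ forall i, (i <= n)%N -> fg_free (F i),
      surj eps,
      (0 < n)%N -> exact_at (d 0%N) eps
    & forall i, (i.+1 < n)%N -> exact_at (d i.+1) (d i)].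

Definition G_ring (n d : nat) (R : comPzRingType) : Prop :=
  forall M : lmodType R, n_presented n M -> enat_le (Gpd M) (Some d).

Definition is_ideal (R : comPzRingType) (I : R -> Prop) : Prop :=
  [/\ I 0, forall x y, I x -> I y -> I (x + y) & forall a x, I x -> I (a * x)].

Definition noetherian (R : comPzRingType) : Prop :=
  forall I : R -> Prop, is_ideal I ->
    exists (n : nat) (g : 'I_n -> R),
      forall x, I x <-> exists c : 'I_n -> R, x = \sum_i c i * g i.

(* Main.v *)
From HB Require Import structures.
From mathcomp Require Import all_boot all_order all_algebra.
From mathcomp Require Import boolp classical_sets functions.
Require Import Defs.

(** Why the theorem holds.

    The ring [R = trivext E] is local, its maximal ideal is a copy of [E], and
    that ideal has square zero.

    (1) A 2-presented [R]-module is projective ([presented2_projective]). Write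
    its presentation with matrices [A] and [B] over [R], so that the row space
    of [B] is the left kernel of [A]. The cokernel of [A] is projective as soon
    as [A] has a generalized inverse [G], that is [A *m G *m A = A]. Over the
    residue field one exists; lifting it to [R] meets an obstruction in [E],
    and a nonzero obstruction would yield scalar row vectors [x] that are
    outside the residual row space of [B] although every multiple of [x] by an
    element of [E] lies in the row space of [B]. Comparing coordinates, the
    components in [E] of the finitely many entries of [B] would span [E].

    (2) The finitely presented module [R / Re], with [e] nonzero in [E], has
    infinite Gorenstein projective dimension. A module of dimension at most [n]
    satisfies Ext^k(M, R) = 0 for [k > n] ([res_ext_van]). The syzygy of [R /
    Re] is the residue field [K], and the syzygy of [K] is [E], which contains
    [K] as a direct summand. Hence the vanishing of a higher Ext(K, R) descends
    to that of Ext^1(K, R), and Ext^1(K, R) is nonzero: homomorphisms from [E]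
    to [R] include endomorphisms of [E] of rank one, whereas those that extend
    to [R] act on [E] as scalars ([residue_ext_nonzero]).

    (3) A module over [R * S] is the product of an [R]-module and an
    [S]-module, and cutting out a factor or inflating along a projection
    preserves projective and Gorenstein projective modules. So the upper bound
    follows from (1), and the failure for 1-presented modules from (2). For the
    last claim, cyclic [S]-modules are, since [S] is Noetherian, the [S]-parts
    of 2-presented modules; it remains to see that the Gorenstein global
    dimension of [S] is attained on cyclic modules ([Ggldim_cyclic]). This uses
    two facts. If Ext^k(C, Q) = 0 for every cyclic [C], then Ext^k(M, Q) = 0
    for every [M] ([cyclic_ext_van]): a module is a transfinite union of
    submodules with cyclic successive quotients, functorial free resolutions
    carry this filtration to syzygies, and for Ext^1 extensions of maps are
    built by Zorn's lemma. And, when all modules have finite Gorenstein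
    projective dimension, a module with no higher Ext into projectives is
    Gorenstein projective ([proj_orth_gproj]), by the Auslander-Buchweitz
    embedding into a module of finite projective dimension; then the [n]-th
    syzygy of a module with Ext^k = 0 into projectives for [k > n] is
    Gorenstein projective. *)

Set Implicit Arguments.
Unset Strict Implicit.
Unset Printing Implicit Defensive.

Import GRing.Theory.

Local Open Scope quotient_scope.
Local Open Scope ring_scope.

(** * Submodules, quotients and maps *)

(** Linear maps are obtained below by choice, so their linearity is proved
    before they can be bundled. *)
Lemma linear_map_of (R : comPzRingType) (A B : lmodType R) (f : A -> B) :
  linear f -> {g : {linear A -> B} | forall x, g x = f x}.
Proof.
move=> lf; pose m := GRing.isLinear.Build R A B *:%R f lf.
by exists (HB.pack_for {linear A -> B} f m).
Qed.

Section Modules.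
Variable R : comPzRingType.
Implicit Types A B C D M N P Q : lmodType R.

Definition submodule M (S : M -> Prop) : Prop :=
  S 0 /\ forall a x y, S x -> S y -> S (a *: x + y).

Definition ses A B C (i : {linear A -> B}) (p : {linear B -> C}) : Prop :=
  [/\ injective i, surj p & exact_at i p].

Lemma factor_surj A B C (p : {linear A -> B}) (f : {linear A -> C}) :
  surj p -> (forall x, p x = 0 -> f x = 0) ->
  exists g : {linear B -> C}, forall x, g (p x) = f x.
Proof.
move=> ps ker; have [s sP] := choice ps.
have eqf x y : p x = p y -> f x = f y.
  move=> pxy; apply/eqP; rewrite -subr_eq0 -linearB; apply/eqP/ker.
  by rewrite linearB /= pxy subrr.
have lin : linear (f \o s).
  by move=> a x y /=; rewrite -linearP; apply: eqf; rewrite linearP /= !sP.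
have [g gP] := linear_map_of lin.
by exists g => x; rewrite gP /=; apply: eqf.
Qed.

Lemma lift_inj A B C (i : {linear A -> B}) (f : {linear C -> B}) :
  injective i -> (forall x, exists y, i y = f x) ->
  exists g : {linear C -> A}, forall x, i (g x) = f x.
Proof.
move=> ii im; have [s sP] := choice im.
have lin : linear s by move=> a x y; apply: ii; rewrite linearP !sP linearP.
by have [g gP] := linear_map_of lin; exists g => x; rewrite gP.
Qed.

Lemma linear_injP A B (f : {linear A -> B}) :
  (forall x, f x = 0 -> x = 0) -> injective f.
Proof.
move=> f0 x y /eqP; rewrite -subr_eq0 -linearB => /eqP/f0/eqP.
by rewrite subr_eq0 => /eqP.
Qed.

End Modules.

Section Submodule.
Variables (R : comPzRingType) (M : lmodType R) (S : M -> Prop).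
Hypothesis subS : submodule S.

Let pS : {pred M} := fun x => `[< S x >].

Fact submodule_closed : submod_closed pS.
Proof.
case: subS => S0 SP; split=> [|a x y /asboolP Sx /asboolP Sy].
  exact/asboolP.
by apply/asboolP/SP.
Qed.

HB.instance Definition _ := GRing.isSubmodClosed.Build R M pS submodule_closed.

Let subM := {x : M | pS x}.
HB.instance Definition _ := SubChoice.on subM.
HB.instance Definition _ := [SubChoice_isSubLmodule of subM by <:].

(** Modules are only needed up to isomorphism: all later constructions
    (kernels, pullbacks, cokernels, covers) are used through such existence
    statements, and diagrams are chased on elements. *)
Lemma sub_exists :
  exists (N : lmodType R) (i : {linear N -> M}),
    injective i /\ forall x, S x <-> exists y, i y = x.
Proof.
exists subM, (val : {linear subM -> M}); split=> [|x]; first exact: val_inj.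
split=> [Sx | [[y Sy] /= <-]]; last exact/asboolP.
by exists (exist _ x (asboolT Sx)).
Qed.

End Submodule.

Section Quotient.
Variables (R : comPzRingType) (M : lmodType R) (S : zmodClosed M).
Hypothesis scaleS : forall a x, x \in S -> a *: x \in S.

Local Notation Q := (Quotient.quot S).

Definition quot_scale (a : R) (x : Q) : Q := \pi_Q (a *: repr x).

Fact quot_scale_pi a x : quot_scale a (\pi_Q x) = \pi_Q (a *: x).
Proof.
apply/eqP; rewrite -Quotient.idealrBE -scalerBr scaleS //.
by rewrite Quotient.idealrBE reprK.
Qed.

Fact quot_scaleA a b x :
  quot_scale a (quot_scale b x) = quot_scale (a * b) x.
Proof. by elim/quotW: x => x; rewrite [quot_scale b _]quot_scale_pi
  !quot_scale_pi scalerA. Qed.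

Fact quot_scale1 : left_id 1 quot_scale.
Proof. by elim/quotW=> x; rewrite quot_scale_pi scale1r. Qed.

Fact quot_scaleDr : right_distributive quot_scale +%R.
Proof.
move=> a; elim/quotW=> x; elim/quotW=> y.
by rewrite -raddfD !quot_scale_pi scalerDr raddfD.
Qed.

Fact quot_scaleDl x : {morph quot_scale^~ x : a b / a + b}.
Proof.
by elim/quotW: x => x a b; rewrite !quot_scale_pi scalerDl raddfD.
Qed.

Definition quot_module : lmodType R := HB.pack_for (lmodType R) Q
  (GRing.Zmodule_isLmodule.Build R Q
     quot_scaleA quot_scale1 quot_scaleDr quot_scaleDl).

Lemma quot_pi_linear : linear (\pi_Q : M -> quot_module).
Proof.
move=> a x y; rewrite raddfD; congr (_ + _); exact/esym/quot_scale_pi.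
Qed.

End Quotient.

Lemma quot_exists (R : comPzRingType) (M : lmodType R) (S : M -> Prop) :
  submodule S ->
  exists (N : lmodType R) (p : {linear M -> N}),
    surj p /\ forall x, p x = 0 <-> S x.
Proof.
move=> subS; pose pS : {pred M} := fun x => `[< S x >].
have cS := submodule_closed subS.
pose zS : zmodClosed M := HB.pack_for (zmodClosed M) pS
  (GRing.isZmodClosed.Build M pS (GRing.submod_closedB cS)).
have scS a x : x \in zS -> a *: x \in zS.
  by move=> zx; rewrite -[_ *: _]addr0; apply: cS.2 => //; case: (cS).
have [p pP] := linear_map_of (quot_pi_linear scS).
exists (quot_module scS), p; split=> [y | x].
  by exists (repr y); rewrite pP; apply: reprK.
have -> : S x <-> x - 0 \in (zS : {pred M}).
  by rewrite subr0; split=> [Sx | /asboolP //]; apply/asboolP.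
rewrite Quotient.idealrBE pP -[0](raddf0 (\pi_(Quotient.quot zS))).
by split=> [-> // | /eqP ->].
Qed.

(** * Free modules and projective covers *)

Section Free.
Variables (R : comPzRingType) (Z : choiceType) (D : Z -> Prop).

Definition supported_by (f : Z -> R^o) (s : seq Z) : Prop :=
  uniq s /\ forall z, z \notin s -> f z = 0.

(** [P] is free on the subset [D] of [Z]: [c] gives the coordinates and [e z]
    is the basis vector of [z]. The generators are restricted to a subset of a
    fixed type so that free modules on different subsets can be compared. *)
Definition free_on (P : lmodType R) (c : {linear P -> (Z -> R^o)})
    (e : Z -> P) : Prop :=
  [/\ injective c, forall x, exists s, supported_by (c x) s,
      forall x z, ~ D z -> c x z = 0
    & forall z w, D z -> c (e z) w = (z == w)%:R].

Lemma free_exists : exists P c e, @free_on P c e.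
Proof.
pose S (f : Z -> R^o) :=
  (exists s, supported_by f s) /\ forall z, ~ D z -> f z = 0.
have subS : submodule S.
  split=> [|a f g [[s [us fs]] fD] [[t [ut gt]] gD]].
    by split=> //; exists [::].
  split=> [|z Dz]; last first.
    by rewrite -[LHS]/(a * f z + g z) fD // gD // mulr0 addr0.
  exists (undup (s ++ t)); split=> [|z]; first exact: undup_uniq.
  rewrite mem_undup mem_cat => /norP[zs zt].
  by rewrite -[LHS]/(a * f z + g z) fs // gt // mulr0 addr0.
have [P [c [ic cP]]] := sub_exists subS.
pose d z : Z -> R^o := fun w => (`[< D z >] && (z == w))%:R.
have Sd z : S (d z).
  split; last first.
    move=> w Dw; rewrite /d; case: eqVneq => [->|]; last by rewrite andbF.
    by rewrite (asboolF Dw).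
  exists [:: z]; split=> // w; rewrite inE /d eq_sym => /negPf->.
  by rewrite andbF.
have [e eP] := choice (fun z => (cP (d z)).1 (Sd z)).
exists P, c, e; split=> // [x | x z Dz | z w Dz].
- by have [] : S (c x) by apply/cP; exists x.
- by have [_ ->] : S (c x) by apply/cP; exists x.
- by rewrite eP /d (asboolT Dz).
Qed.

Lemma sum_supported (M : lmodType R) (f : Z -> R^o) (a : Z -> M) s t :
  supported_by f s -> supported_by f t ->
  \sum_(z <- s) f z *: a z = \sum_(z <- t) f z *: a z.
Proof.
have restr u v : supported_by f v ->
    \sum_(z <- u) f z *: a z = \sum_(z <- u | z \in v) f z *: a z.
  move=> [_ fv]; rewrite [RHS]big_mkcond; apply: eq_bigr => z _.
  by case: ifPn => // /fv ->; rewrite scale0r.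
move=> fs ft; rewrite (restr s t) // (restr t s) //.
rewrite -big_filter -[RHS]big_filter; apply: perm_big.
apply: uniq_perm; rewrite ?filter_uniq //; [by case: fs | by case: ft |].
by move=> z; rewrite !mem_filter andbC.
Qed.

Variables (P : lmodType R) (c : {linear P -> (Z -> R^o)}) (e : Z -> P).
Hypothesis freeP : free_on c e.

Lemma free_lift (M : lmodType R) (a : Z -> M) :
  exists h : {linear P -> M},
    forall x s, supported_by (c x) s -> h x = \sum_(z <- s) c x z *: a z.
Proof.
have [_ fin _ _] := freeP.
have [supp suppP] := choice fin.
pose h x := \sum_(z <- supp x) c x z *: a z.
have hP x s : supported_by (c x) s -> h x = \sum_(z <- s) c x z *: a z.
  by move=> xs; apply: sum_supported.
have lin : linear h.
  move=> k x y; pose s := undup (supp x ++ supp y).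
  have ss u v : supported_by (c u) v -> {subset v <= s} ->
      supported_by (c u) s.
    move=> [_ uv] sub; split=> [|z zs]; first exact: undup_uniq.
    by apply: uv; apply: contra zs => /sub.
  have xs : supported_by (c x) s.
    by apply: ss (suppP x) _ => z; rewrite mem_undup mem_cat => ->.
  have ys : supported_by (c y) s.
    by apply: ss (suppP y) _ => z; rewrite mem_undup mem_cat orbC => ->.
  rewrite (hP x s) // (hP y s) // (hP _ s); last first.
    split=> [|z zs]; first exact: undup_uniq.
    rewrite linearP -[LHS]/(k * c x z + c y z) xs.2 // ys.2 //.
    by rewrite mulr0 addr0.
  rewrite scaler_sumr -big_split; apply: eq_bigr => z _ /=.
  by rewrite linearP -[(_ + _) z]/(k * c x z + c y z) scalerDl scalerA.
by have [g gP] := linear_map_of lin; exists g => x s xs; rewrite gP (hP x s).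
Qed.

Lemma supported_gen z : D z -> supported_by (c (e z)) [:: z].
Proof.
have [_ _ _ ce] := freeP.
by move=> Dz; split=> // w; rewrite inE ce // eq_sym => /negPf->.
Qed.

Lemma free_lift_gen (M : lmodType R) (a : Z -> M) :
  exists h : {linear P -> M}, forall z, D z -> h (e z) = a z.
Proof.
have [_ _ _ ce] := freeP; have [h hP] := free_lift a; exists h => z Dz.
by rewrite (hP _ [:: z] (supported_gen Dz)) big_seq1 ce // eqxx scale1r.
Qed.

Lemma free_expand x s :
  supported_by (c x) s -> x = \sum_(z <- s) c x z *: e z.
Proof.
have [ic _ cD ce] := freeP; move=> xs; apply: ic; apply: funext => w.
have eval (y : P) : c y w = (fun f : Z -> R^o => f w) (c y) by [].
have evalD : forall t, c (\sum_(z <- t) c x z *: e z) w =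
    \sum_(z <- t) c x z * c (e z) w.
  elim=> [|z t IH]; first by rewrite !big_nil linear0.
  by rewrite !big_cons linearP -[LHS]/(_ * _ + _) IH.
rewrite evalD; have [ws | ws] := boolP (w \in s); last first.
  rewrite xs.2 // big_seq big1 // => z zs.
  have [Dz | Dz] := pselect (D z); last by rewrite cD // mul0r.
  by rewrite ce //; case: eqVneq zs ws => [-> -> // | _ _ _]; rewrite mulr0.
rewrite (bigD1_seq w) //=; last by case: xs.
rewrite big1 => [|z zw]; last first.
  have [Dz | Dz] := pselect (D z); last by rewrite cD // mul0r.
  by rewrite ce // (negPf zw) mulr0.
have [Dw | Dw] := pselect (D w); last by rewrite cD // mul0r addr0.
by rewrite ce // eqxx mulr1 addr0.
Qed.

(** Maps that agree on the generators in [A] agree on the vectors supported in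
    [A]. *)
Lemma free_gen_ext_on (A : Z -> Prop) (M : lmodType R) (f g : {linear P -> M}) :
  (forall z, D z -> A z -> f (e z) = g (e z)) ->
  forall x, (forall z, ~ A z -> c x z = 0) -> f x = g x.
Proof.
have [_ fin cD _] := freeP; move=> fg x xA; have [s xs] := fin x.
rewrite (free_expand xs) !linear_sum; apply: eq_bigr => z _.
rewrite !linearZ /=; have [Dz | Dz] := pselect (D z); last first.
  by rewrite cD // !scale0r.
by have [Az | Az] := pselect (A z); [rewrite fg | rewrite xA // !scale0r].
Qed.

Lemma free_gen_ext (M : lmodType R) (f g : {linear P -> M}) :
  (forall z, D z -> f (e z) = g (e z)) -> forall x, f x = g x.
Proof. by move=> fg x; apply: (@free_gen_ext_on (fun=> True)) => // z /fg. Qed.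

Lemma free_projective : projective P.
Proof.
move=> A B g f gs; have [a aP] := choice (fun z => gs (f (e z))).
have [h hP] := free_lift_gen a; exists h => x.
rewrite -[g (h x)]/((g \o h) x); move: x; apply: free_gen_ext => z Dz /=.
by rewrite hP // aP.
Qed.

End Free.

Lemma proj_cover (R : comPzRingType) (M : lmodType R) :
  exists (P : lmodType R) (p : {linear P -> M}), projective P /\ surj p.
Proof.
have [P [c [e freeP]]] := free_exists R (fun _ : M => True).
have [p pP] := free_lift_gen freeP (@id M); exists P, p.
by split=> [|z]; [exact: free_projective freeP | exists (e z); rewrite pP].
Qed.

Lemma kernel_exists (R : comPzRingType) (A B : lmodType R)
    (p : {linear A -> B}) :
  exists (N : lmodType R) (i : {linear N -> A}), injective i /\ exact_at i p.
Proof.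
have subK : submodule (fun x => p x = 0).
  by split=> [|a x y xp yp]; rewrite ?linear0 // linearP xp yp scaler0 addr0.
by have [N [i [ii iP]]] := sub_exists subK; exists N, i.
Qed.

Lemma image_submodule (R : comPzRingType) (A B : lmodType R)
    (f : {linear A -> B}) :
  submodule (fun y => exists x, f x = y).
Proof.
split=> [|a _ _ [x <-] [y <-]]; first by exists 0; rewrite linear0.
by exists (a *: x + y); rewrite linearP.
Qed.

Lemma coker_exists (R : comPzRingType) (A B : lmodType R)
    (i : {linear A -> B}) :
  exists (N : lmodType R) (p : {linear B -> N}), surj p /\ exact_at i p.
Proof. exact: quot_exists (image_submodule i). Qed.

Lemma proj_ses_exists (R : comPzRingType) (M : lmodType R) :
  exists (N P : lmodType R) (i : {linear N -> P}) (p : {linear P -> M}),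
    projective P /\ ses i p.
Proof.
have [P [p [pP ps]]] := proj_cover M; have [N [i [ii iP]]] := kernel_exists p.
by exists N, P, i, p.
Qed.

(** * Vanishing of Ext *)

Section ExtVanishing.
Variable R : comPzRingType.
Implicit Types A B C D G H M N P Q W Y Z : lmodType R.

Definition extends Q N P (i : {linear N -> P}) : Prop :=
  forall u : {linear N -> Q}, exists v : {linear P -> Q},
    forall x, v (i x) = u x.

(** Vanishing of Ext^[n+1] from [M] to [Q], by dimension shifting. For [n = 0]
    the middle term of the extension is arbitrary: this makes the closure of
    Ext^1 vanishing under retracts and extensions a matter of pullbacks, and
    [ext_van0_proj] recovers the usual test on one projective presentation. *)
Fixpoint ext_van Q (n : nat) M : Prop :=
  match n with
  | 0 => forall N P (i : {linear N -> P}) (p : {linear P -> M}),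
      ses i p -> extends Q i
  | n.+1 => forall N P (i : {linear N -> P}) (p : {linear P -> M}),
      projective P -> ses i p -> ext_van Q n N
  end.

Lemma ses_comp0 A B C (i : {linear A -> B}) (p : {linear B -> C}) :
  ses i p -> forall x, p (i x) = 0.
Proof. by case=> _ _ ex x; apply/ex; exists x. Qed.

Lemma pair_map_exists A B C (f : {linear A -> C}) (g : {linear B -> C}) :
  exists h : {linear (A * B)%type -> C}, forall x, h x = f x.1 + g x.2.
Proof.
have lin : linear (fun x : A * B => f x.1 + g x.2).
  by move=> k x y; rewrite /= !linearP scalerDr addrACA.
by have [h hP] := linear_map_of lin; exists h.
Qed.

Lemma copair_map_exists A B C (f : {linear C -> A}) (g : {linear C -> B}) :
  exists h : {linear C -> (A * B)%type}, forall x, h x = (f x, g x).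
Proof.
have lin : linear (fun x => (f x, g x)).
  by move=> k x y; rewrite !linearP.
by have [h hP] := linear_map_of lin; exists h.
Qed.

Lemma inl_exists A B :
  exists h : {linear A -> (A * B)%type}, forall x, h x = (x, 0).
Proof.
have [h hP] := copair_map_exists (idfun : {linear A -> A})
  (\0 : {linear A -> B}).
by exists h.
Qed.

Lemma inr_exists A B :
  exists h : {linear B -> (A * B)%type}, forall x, h x = (0, x).
Proof.
have [h hP] := copair_map_exists (\0 : {linear B -> A})
  (idfun : {linear B -> B}).
by exists h.
Qed.

Lemma sub_map_exists A B (f g : {linear A -> B}) :
  exists h : {linear A -> B}, forall x, h x = f x - g x.
Proof.
have lin : linear (fun x => f x - g x).
  by move=> k x y; rewrite !linearP /= scalerBr scalerN addrACA.
by have [h hP] := linear_map_of lin; exists h.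
Qed.

Lemma line_exists M (x : M) : exists h : {linear R^o -> M}, forall r, h r = r *:
  x.
Proof.
have lin : linear (fun r : R^o => r *: x).
  by move=> k r r'; rewrite scalerDl scalerA.
by have [h hP] := linear_map_of lin; exists h.
Qed.

Lemma proj_retract P P' (a : {linear P -> P'}) (r : {linear P' -> P}) :
  (forall x, r (a x) = x) -> projective P' -> projective P.
Proof.
move=> ra pP' A B g f gs; have [h hP] := pP' A B g (f \o r) gs.
by exists (h \o a) => x /=; rewrite hP /= ra.
Qed.

Lemma proj_sum P P' :
  projective P -> projective P' -> projective (P * P')%type.
Proof.
move=> pP pP' A B g f gs.
have [h1 h1P] := inl_exists P P'.
have [h2 h2P] := inr_exists P P'.
have [u uP] := pP A B g (f \o h1) gs; have [v vP] := pP' A B g (f \o h2) gs.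
have [h hP] := pair_map_exists u v; exists h => -[x y].
rewrite hP linearD uP vP /= h1P h2P -linearD; congr (f _).
by congr (_, _); rewrite /= ?addr0 ?add0r.
Qed.

Lemma ses_splits N P M (i : {linear N -> P}) (p : {linear P -> M})
    (s : {linear M -> P}) :
  ses i p -> (forall x, p (s x) = x) ->
  exists r : {linear P -> N}, (forall x, r (i x) = x)
    /\ forall y, i (r y) = y - s (p y).
Proof.
case=> ii ps ex sP; have [d dP] := sub_map_exists idfun (s \o p).
have [|r rP] := lift_inj (f := d) ii.
  by move=> x; apply/ex; rewrite dP linearB /= sP subrr.
exists r; split=> [x | y]; last by rewrite rP dP.
by apply: (ii); rewrite rP dP /= (ses_comp0 (And3 ii ps ex)) linear0 subr0.
Qed.

Lemma ses_proj_retract N P M (i : {linear N -> P}) (p : {linear P -> M}) :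
  ses i p -> projective M -> exists r : {linear P -> N}, forall x, r (i x) = x.
Proof.
move=> ex pM; have [_ ps _] := ex.
have [s sP] := pM _ _ p idfun ps.
by have [r [rP _]] := ses_splits ex sP; exists r.
Qed.

Lemma proj_ext_van Q n P : projective P -> ext_van Q n P.
Proof.
elim: n P => [|n IH] P pP N Y i p => [ex | pY ex].
  have [r rP] := ses_proj_retract ex pP => u.
  by exists (u \o r) => x /=; rewrite rP.
have [r rP] := ses_proj_retract ex pP.
by apply: IH; apply: proj_retract rP pY.
Qed.

(** An arbitrary presentation of [M] is a quotient of the sum of its kernel and
    [P], so a map on the kernel and an extension on [P] that agree on the
    intersection glue. *)
Lemma ext_van0_proj Q N P M (i : {linear N -> P}) (p : {linear P -> M}) :
  projective P -> ses i p -> extends Q i -> ext_van Q 0 M.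
Proof.
move=> pP ex ext N' P' i' p' ex' u'.
have [_ ps' ex'3] := ex'; have [h hP] := pP _ _ p' p ps'.
have [ii' _ _] := ex'; have [_ ps ex3] := ex.
have [|k kP] := lift_inj (f := h \o i) ii'.
  by move=> x; apply/ex'3; rewrite /= hP (ses_comp0 ex).
have [v vP] := ext (u' \o k).
have [d dP] := pair_map_exists h i'.
have [w wP] := pair_map_exists v u'.
have ds : surj d.
  move=> y; have [x xP] := ps (p' y).
  have /ex'3[n nP] : p' (y - h x) = 0 by rewrite linearB /= hP xP subrr.
  by exists (x, n); rewrite dP /= nP addrC subrK.
have [|g gP] := factor_surj (f := w) ds.
  move=> [x n]; rewrite dP wP /= => /eqP; rewrite addr_eq0 => /eqP hx.
  have /ex3[m mP] : p x = 0.
    by rewrite -hP hx linearN /= (ses_comp0 ex') oppr0.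
  rewrite -mP vP /=; have -> : k m = - n.
    by apply: ii'; rewrite kP /= mP hx linearN.
  by rewrite linearN addNr.
exists g => x; have -> : i' x = d (0, x) by rewrite dP /= linear0 add0r.
by rewrite gP wP /= linear0 add0r.
Qed.

(** Schanuel's lemma for retracts. The lifts [al] and [be] of [a] and [r] to
    the covers satisfy [be al = 1] only modulo [N]; the difference [1 - be al]
    maps [P] to [N] and corrects the retraction. *)
Lemma syz_retract M M' N P N' P' (a : {linear M -> M'}) (r : {linear M' -> M})
    (i : {linear N -> P}) (p : {linear P -> M})
    (i' : {linear N' -> P'}) (p' : {linear P' -> M'}) :
  (forall x, r (a x) = x) -> projective P -> projective P' ->
  ses i p -> ses i' p' ->
  exists (b : {linear N -> (N' * P)%type}) (s : {linear (N' * P)%type -> N}),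
    forall x, s (b x) = x.
Proof.
move=> ra pP pP' ex ex'.
have [[ii ps ex3] [ii' ps' ex3']] := (ex, ex').
have [al alP] := pP _ _ p' (a \o p) ps'.
have [be beP] := pP' _ _ p (r \o p') ps.
have [al0 al0P] : exists g : {linear N -> N'}, forall x, i' (g x) = (al \o i) x.
  apply: lift_inj => // x; apply/ex3'.
  by rewrite /= alP /= (ses_comp0 ex) linear0.
have [be0 be0P] : exists g : {linear N' -> N}, forall x, i (g x) = (be \o i') x.
  apply: lift_inj => // x; apply/ex3.
  by rewrite /= beP /= (ses_comp0 ex') linear0.
have [d dP] := sub_map_exists idfun (be \o al).
have [d0 d0P] : exists g : {linear P -> N}, forall x, i (g x) = d x.
  apply: lift_inj => // x; apply/ex3.
  by rewrite dP linearB /= beP /= alP /= ra subrr.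
have [b bP] := copair_map_exists al0 i.
have [s sP] := pair_map_exists be0 d0.
exists b, s => x; apply: ii; rewrite sP bP /= linearD be0P d0P /= al0P dP /=.
by rewrite addrC subrK.
Qed.

Definition ext_closed (X : lmodType R -> Prop) : Prop :=
  forall A B C (i : {linear A -> B}) (p : {linear B -> C}),
    ses i p -> X A -> X C -> X B.

Definition retract_closed (X : lmodType R -> Prop) : Prop :=
  forall M M' (a : {linear M -> M'}) (r : {linear M' -> M}),
    (forall x, r (a x) = x) -> X M' -> X M.

(** Third isomorphism theorem, for the kernels of [p] and of [q \o p]. *)
Lemma ses_comp A B C N P N1 (i : {linear A -> B}) (q : {linear B -> C})
    (j : {linear N -> P}) (p : {linear P -> B}) (k : {linear N1 -> P}) :
  ses i q -> ses j p -> ses k (q \o p) ->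
  exists (l : {linear N -> N1}) (t : {linear N1 -> A}),
    ses l t /\ forall x, k (l x) = j x.
Proof.
move=> ex1 ex2 ex3; have [[[ii qs e1] [ij ps e2]] [ik _ e3]] := (ex1, ex2, ex3).
have [l lP] : exists g : {linear N -> N1}, forall x, k (g x) = j x.
  apply: lift_inj => // x; apply/e3.
  by rewrite /= (ses_comp0 ex2) linear0.
have [t tP] : exists g : {linear N1 -> A}, forall x, i (g x) = (p \o k) x.
  by apply: lift_inj => // x; apply/e1; apply: (ses_comp0 ex3).
exists l, t; split=> //; split=> [x y lxy | y | x].
- by apply: ij; rewrite -!lP lxy.
- have [z zP] := ps (i y).
  have /e3[x xP] : q (p z) = 0 by rewrite zP (ses_comp0 ex1).
  by exists x; apply: ii; rewrite tP /= xP.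
- split=> [tx | [y <-]]; last first.
    by apply: ii; rewrite tP /= lP (ses_comp0 ex2) linear0.
  have /e2[y yP] : p (k x) = 0 by rewrite -[LHS]tP tx linear0.
  by exists y; apply: ik; rewrite lP.
Qed.

Lemma ses_kernel B C (p : {linear B -> C}) :
  surj p -> exists N (i : {linear N -> B}), ses i p.
Proof. by move=> ps; have [N [i [ii ex]]] := kernel_exists p; exists N, i. Qed.

Lemma surj_comp A B C (f : {linear A -> B}) (g : {linear B -> C}) :
  surj f -> surj g -> surj (g \o f).
Proof.
by move=> fs gs z; have [y <-] := gs z; have [x <-] := fs y; exists x.
Qed.

Lemma ses_pullback A B C D (i : {linear A -> B}) (p : {linear B -> C})
    (f : {linear D -> C}) :
  ses i p ->
  exists W (j : {linear A -> W}) (g : {linear W -> B}) (q : {linear W -> D}),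
    [/\ ses j q, forall x, g (j x) = i x, forall w, p (g w) = f (q w),
        forall w w', g w = g w' -> q w = q w' -> w = w'
      & forall Y (b : {linear Y -> B}) (d : {linear Y -> D}),
          (forall y, p (b y) = f (d y)) ->
        exists h : {linear Y -> W}, forall y, g (h y) = b y /\ q (h y) = d y].
Proof.
move=> ex; have [ii ps e] := ex.
have [s sP] := sub_map_exists (p \o fst : {linear (B * D)%type -> C})
  (f \o snd).
have [W [k [ik kP]]] := kernel_exists s.
(* The universal property also gives the inclusion [j] of the kernel. *)
have univ Y (b : {linear Y -> B}) (d : {linear Y -> D}) :
    (forall y, p (b y) = f (d y)) ->
    exists h : {linear Y -> W}, forall y, (k (h y)).1 = b y /\
      (k (h y)).2 = d y.
  move=> bd; have [c cP] := copair_map_exists b d.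
  have [|h hP] := lift_inj (f := c) ik.
    by move=> y; apply/kP; rewrite sP cP /= bd subrr.
  by exists h => y; rewrite hP cP.
have [|j jP] := univ A i \0; first by move=> y; rewrite (ses_comp0 ex) linear0.
exists W, j, (fst \o k), (snd \o k); split=> //=.
- split=> [x y jxy | y | x] /=.
  + by apply: ii; rewrite -(jP x).1 jxy (jP y).1.
  + have [x xP] := ps (f y).
    have /kP[w wP] : s (x, y) = 0 by rewrite sP /= xP subrr.
    by exists w; rewrite wP.
  + split=> [qx | [y <-]]; last by rewrite (jP y).2.
    have /e[y yP] : p (k x).1 = 0.
      have : s (k x) = 0 by apply/kP; exists x.
      by rewrite sP /= qx linear0 subr0.
    exists y; apply: ik; rewrite [LHS]surjective_pairing
      [RHS]surjective_pairing.
    by rewrite (jP y).1 (jP y).2 yP qx.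
- by move=> x; rewrite (jP x).1.
- move=> w; have : s (k w) = 0 by apply/kP; exists w.
  by rewrite sP /= => /eqP; rewrite subr_eq0 => /eqP.
- move=> w w' w1 w2; apply: ik.
  by rewrite [LHS]surjective_pairing [RHS]surjective_pairing w1 w2.
Qed.

Lemma ext_van0_ext_closed Q : ext_closed (ext_van Q 0).
Proof.
move=> A B C i q exA XA XC N P j p exP u.
have [_ qs _] := exA; have [_ ps _] := exP.
have [N1 [k exk]] := ses_kernel (surj_comp ps qs).
have [l [t [exl kl]]] := ses_comp exA exP exk.
have [v vP] := XA _ _ _ _ exl u.
have [w wP] := XC _ _ _ _ exk v.
by exists w => x; rewrite -kl wP vP.
Qed.

Lemma ext_van0_retract_closed Q : retract_closed (ext_van Q 0).
Proof.
move=> M M' a r ra XM N P i p ex u.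
have [W [j [g [q [exW gj com uniq univ]]]]] := ses_pullback r ex.
have [v vP] := XM _ _ _ _ exW u.
have [|s sP] := univ P idfun (a \o p); first by move=> y; rewrite /= ra.
exists (v \o s) => x /=.
have -> : s (i x) = j x; last exact: vP.
apply: uniq; rewrite ?(sP _).1 ?(sP _).2 ?gj //=.
by rewrite (ses_comp0 ex) linear0 (ses_comp0 exW).
Qed.

(** In terms of the long exact sequence, the term [Z] sits between [W] in the
    same degree and [G] in the next one. To derive it from closure under
    extensions and retracts alone, pull [p] back along a projective cover of
    [G]: the pullback is an extension of [W] by a syzygy of [G], and [Z] is a
    retract of it because the cover lifts to [W]. *)
Lemma ext_van_kernel_step Q n Z W G (i : {linear Z -> W})
    (p : {linear W -> G}) :
  ext_closed (ext_van Q n) -> retract_closed (ext_van Q n) ->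
  ses i p -> ext_van Q n W -> ext_van Q n.+1 G -> ext_van Q n Z.
Proof.
move=> Xe Xr ex XW XG; have [ii ps e] := ex.
have [N [P [j [q [pP exP]]]]] := proj_ses_exists G.
have XN : ext_van Q n N := XG _ _ _ _ pP exP.
have [Y [k [g [t [exY gk com _ univ]]]]] := ses_pullback p exP.
have XY : ext_van Q n Y := Xe _ _ _ _ _ exY XN XW.
have [s sP] := pP _ _ p q ps.
have [d dP] := sub_map_exists t (s \o g).
have [r rP] : exists r : {linear Y -> Z}, forall x, i (r x) = d x.
  by apply: lift_inj => // x; apply/e; rewrite dP linearB /= sP com subrr.
have [|a aP] := univ Z \0 i.
  by move=> y; rewrite (ses_comp0 ex) linear0.
apply: (Xr _ _ a r) XY => x; apply: ii.
by rewrite rP dP /= (aP x).1 (aP x).2 linear0 subr0.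
Qed.

(** Both closure properties are proved together, since in degree [n+1] each of
    them uses both in degree [n]. *)
Lemma ext_van_closed Q n :
  ext_closed (ext_van Q n) /\ retract_closed (ext_van Q n).
Proof.
elim: n => [|n [Xe Xr]].
  by split; [exact: ext_van0_ext_closed | exact: ext_van0_retract_closed].
have Xp : forall M P, ext_van Q n M -> projective P ->
    ext_van Q n (M * P)%type.
  move=> M P XM pP.
  have [h hP] := inl_exists M P.
  apply: (Xe _ _ _ h snd) => //; last exact: proj_ext_van.
  split=> [x y | y | [x y]]; first by rewrite !hP => -[].
  - by exists (0, y).
  - split=> [/= -> | [z]]; last by rewrite hP => -[_ <-].
    by exists x; rewrite hP.
split=> [A B C i q ex XA XC N P j p pP exP | M M' a r ra XM N P i p pP ex].
  have [_ qs _] := ex; have [_ ps _] := exP.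
  have [N1 [k exk]] := ses_kernel (surj_comp ps qs).
  have [l [t [exl kl]]] := ses_comp ex exP exk.
  by apply: (ext_van_kernel_step Xe Xr exl _ XA); apply: XC exk.
have [N' [P' [i' [p' [pP' ex']]]]] := proj_ses_exists M'.
have [b [s sb]] := syz_retract ra pP pP' ex ex'.
by apply: (Xr _ _ b s sb); apply: Xp pP; apply: XM ex'.
Qed.

Lemma ext_van_ext Q n : ext_closed (ext_van Q n).
Proof. by case: (ext_van_closed Q n). Qed.

Lemma ext_van_retract Q n : retract_closed (ext_van Q n).
Proof. by case: (ext_van_closed Q n). Qed.

Lemma ext_van_kernel Q n Z W G (i : {linear Z -> W}) (p : {linear W -> G}) :
  ses i p -> ext_van Q n W -> ext_van Q n.+1 G -> ext_van Q n Z.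
Proof. exact: ext_van_kernel_step (@ext_van_ext Q n) (@ext_van_retract Q n).
  Qed.

Lemma ext_van_sum Q n M M' :
  ext_van Q n M -> ext_van Q n M' -> ext_van Q n (M * M')%type.
Proof.
have [h hP] := inl_exists M M'.
apply: (ext_van_ext (i := h) (p := snd)).
split=> [x y | y | [x y]]; first by rewrite !hP => -[].
- by exists (0, y).
- split=> [/= -> | [z]]; last by rewrite hP => -[_ <-].
  by exists x; rewrite hP.
Qed.

(** A single syzygy decides the vanishing in the next degree. *)
Lemma ext_vanS Q n N P M (i : {linear N -> P}) (p : {linear P -> M}) :
  projective P -> ses i p -> ext_van Q n N -> ext_van Q n.+1 M.
Proof.
move=> pP ex XN N' P' i' p' pP' ex'.
have [b [s sb]] := syz_retract (a := idfun) (r := idfun) (fun=> erefl) pP' pP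
  ex' ex.
apply: ext_van_retract sb _; apply: ext_van_sum => //.
exact: proj_ext_van.
Qed.

Lemma ext_van_coker Q n N G M (i : {linear N -> G}) (p : {linear G -> M}) :
  ses i p -> ext_van Q n N -> ext_van Q n.+1 G -> ext_van Q n.+1 M.
Proof.
move=> ex XN XG; have [Z [P [j [q [pP exP]]]]] := proj_ses_exists M.
apply: (ext_vanS pP exP).
have [W [k [g [t [exW gk com uniq univ]]]]] := ses_pullback q ex.
have XW : ext_van Q n W by apply: ext_van_ext exW XN _; apply: proj_ext_van.
have [ij qs eP] := exP; have [ii ps e] := ex.
have [|a aP] := univ Z \0 j; first by move=> y; rewrite (ses_comp0 exP) linear0.
apply: (@ext_van_kernel Q n Z W G a g) => //; split=> [x y axy | y | w].
- by apply: ij; rewrite -(aP x).2 axy (aP y).2.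
- have [x xP] := qs (p y).
  have [b bP] := line_exists y; have [d dP] := line_exists x.
  have [|h hP] := univ _ b d; first by move=> r; rewrite bP dP !linearZ /= xP.
  by exists (h 1); rewrite (hP 1).1 bP scale1r.
- split=> [gw | [z <-]]; last by rewrite (aP z).1.
  have /eP[z zP] : q (t w) = 0 by rewrite -com gw linear0.
  by exists z; apply: uniq; rewrite ?(aP z).1 ?(aP z).2.
Qed.
End ExtVanishing.

(** * Gorenstein projective modules and their resolutions *)

Section GorensteinProjective.
Variable R : comPzRingType.
Implicit Types A B C D G H M N P Q W Y Z : lmodType R.

(** One step of a totally acyclic complex: such a complex is a family of
    modules, its cycles, indexed by the integers and linked consecutively. The
    extension property expresses the exactness after applying Hom(-, Q). *)
Definition link N N' : Prop :=
  exists P (i : {linear N -> P}) (p : {linear P -> N'}),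
    [/\ projective P, ses i p & forall Q, projective Q -> extends Q i].

Lemma gproj_of_links (Z : int -> lmodType R) :
  (forall i, link (Z i) (Z (i + 1))) -> gorenstein_projective (Z (-1 + 1)).
Proof.
move=> links.
have H k : {P : lmodType R & {ip : {linear Z k -> P} * {linear P -> Z (k + 1)} |
    [/\ projective P, ses ip.1 ip.2
      & forall Q, projective Q -> extends Q ip.1]}}.
  have [P HP] := cid (links k); have [i Hi] := cid HP; have [p Hp] := cid Hi.
  by exists P, (i, p).
pose P k := projT1 (H k).
pose i k : {linear Z k -> P k} := (sval (projT2 (H k))).1.
pose p k : {linear P k -> Z (k + 1)} := (sval (projT2 (H k))).2.
have pP k : projective (P k) by case: (svalP (projT2 (H k))).
have ex k : ses (i k) (p k) by case: (svalP (projT2 (H k))).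
have ext k Q (pQ : projective Q) : extends Q (i k).
  case: (svalP (projT2 (H k))) => _ _ h. exact: h.
exists P, (fun k => (i (k + 1) \o p k)), (i (-1 + 1));
  split=> // [k x | Q pQ k u ||x].
- have [i1 _ _] := ex (k + 1 + 1); have [_ ps _] := ex k.
  have [_ _ e] := ex (k + 1); split=> /= [| [y <-]]; last first.
    by rewrite (ses_comp0 (ex (k + 1))) linear0.
  rewrite -(linear0 (i (k + 1 + 1))) => /i1/e[z zP].
  by have [y yP] := ps z; exists y; rewrite yP.
- have [_ ps0 _] := ex k; have [_ ps _] := ex (k + 1).
  have [_ _ e] := ex (k + 1); split=> [u0 | [v vP] x]; last first.
    by rewrite -vP /= (ses_comp0 (ex (k + 1))) !linear0.
  have [|w wP] := factor_surj (f := u) ps.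
    by move=> x /e[y <-]; have [z <-] := ps0 y; apply: u0.
  have [v vP] := ext (k + 1 + 1) Q pQ w.
  by exists v => y; rewrite /= vP wP.
- by case: (ex (-1 + 1)).
- have [_ ps _] := ex (-1); split=> [[m <-] | [y <-]];
    last by exists (p (-1) y).
  by have [y <-] := ps m; exists y.
Qed.

(** The cycles of the complex are linked. Exactness of Hom(-, Q) in degree
    [k+1] gives extensions from the cycles in degree [k+2], hence the double
    shifts. *)
Lemma links_of_gproj M : gorenstein_projective M ->
  exists Z : int -> lmodType R, (forall i, link (Z i) (Z (i + 1))) /\
    exists f : {linear M -> Z (-1 + 1)}, injective f /\ surj f.
Proof.
case=> P [d [e [pP ex hom ie im]]].
have H k : {Z : lmodType R & {i : {linear Z -> P k} |
    injective i /\ exact_at i (d k)}}.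
  have [Z HZ] := cid (kernel_exists (d k)); have [i Hi] := cid HZ.
  by exists Z, i.
pose Z k := projT1 (H k).
pose i k : {linear Z k -> P k} := sval (projT2 (H k)).
have ii k : injective (i k) by case: (svalP (projT2 (H k))).
have ei k : exact_at (i k) (d k) by case: (svalP (projT2 (H k))).
have dd k x : d (k + 1) (d k x) = 0 by apply/ex; exists x.
have hp k : {p : {linear P k -> Z (k + 1)} | forall x, i (k + 1) (p x) = d k x}.
  by apply: cid; apply: lift_inj (ii _) _ => x; apply/ei.
pose p k := sval (hp k); have pE k x : i (k + 1) (p k x) = d k x :=
  svalP (hp k) x.
have ps k : surj (p k).
  move=> y; have /ex[x xP] : d (k + 1) (i (k + 1) y) = 0 by apply/ei; exists y.
  by exists x; apply: ii; rewrite pE.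
have sesZ k : ses (i k) (p k).
  split=> // x; rewrite -ei; split=> [px | dx]; first by rewrite -pE px linear0.
  by apply: ii; rewrite pE dx linear0.
have linkZ k : link (Z (k + 1 + 1)) (Z (k + 1 + 1 + 1)).
  exists (P (k + 1 + 1)), (i (k + 1 + 1)), (p (k + 1 + 1)); split=> // Q pQ u.
  have [|v vP] := (hom Q pQ k (u \o p (k + 1))).1.
    move=> x /=; have -> : p (k + 1) (d k x) = 0; last by rewrite linear0.
    by apply: ii; rewrite pE dd linear0.
  exists v => z; have [y <-] := ps (k + 1) z.
  by rewrite pE vP.
exists Z; split=> [k|].
  by rewrite -(subrK 1 k) -(subrK 1 (k - 1)).
have [|f fP] := lift_inj (f := e) (ii (-1 + 1)).
  move=> m; apply/ei; have /im[y <-] : exists m', e m' = e m by exists m.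
  exact: dd.
exists f; split=> [x y fxy | z]; first by apply: ie; rewrite -!fP fxy.
have /ex/im[m mP] : d (-1 + 1) (i (-1 + 1) z) = 0 by apply/ei; exists z.
by exists m; apply: ii; rewrite fP.
Qed.

Lemma link_isol N N1 N2 (f : {linear N -> N1}) :
  injective f -> surj f -> link N1 N2 -> link N N2.
Proof.
move=> fi fs [P [i [p [pP [ii ps e] ext]]]].
have [|g gP] := lift_inj (f := idfun) fi; first exact: fs.
exists P, (i \o f), p; split=> // [|Q pQ u]; last first.
  have [v vP] := ext Q pQ (u \o g); exists v => x.
  by rewrite /= vP /=; congr (u _); apply: fi; rewrite gP.
split=> // [x y /= /ii/fi // | x]; rewrite e.
split=> [[y <-] | [y <-]]; last by exists (f y).
by have [z <-] := fs y; exists z.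
Qed.

Lemma link_isor N N1 N2 (f : {linear N1 -> N2}) :
  injective f -> surj f -> link N N1 -> link N N2.
Proof.
move=> fi fs [P [i [p [pP [ii ps e] ext]]]].
exists P, i, (f \o p); split=> //; split=> //; first exact: surj_comp.
by move=> x; rewrite -e /= -(linear0 f); split=> [/fi | ->].
Qed.

Definition link_closed (X : lmodType R -> Prop) : Prop :=
  forall N, X N -> (exists2 N', X N' & link N N') /\
    (exists2 N', X N' & link N' N).

(** Coinductive description of Gorenstein projective modules. It removes the
    integer-indexed families: closure properties are proved by exhibiting a
    class of modules that is stable under taking a link on either side. *)
Lemma gprojP M :
  gorenstein_projective M <-> exists2 X, link_closed X & X M.
Proof.
split=> [/links_of_gproj[Z [linkZ [f [fi fs]]]] | [X clX XM]].
  exists (fun N => exists k (g : {linear N -> Z k}), injective g /\ surj g).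
    move=> N [k [g [gi gs]]]; split.
      exists (Z (k + 1)); last exact: link_isol gi gs (linkZ k).
      by exists (k + 1), idfun; split=> // x; exists x.
    exists (Z (k - 1)).
      by exists (k - 1), idfun; split=> // x; exists x.
    have [|h hP] := lift_inj (f := idfun) gi; first exact: gs.
    have := linkZ (k - 1); rewrite subrK; apply: (link_isor (f := h)).
      by move=> x y hxy; rewrite -[x]hP hxy hP.
    by move=> x; exists (g x); apply: gi; rewrite hP.
  by exists (-1 + 1), f.
pose S := {N : lmodType R | X N}.
have /choice[nx nxP] : forall s : S, exists s' : S, link (sval s) (sval s').
  move=> [N XN] /=; have [[N' XN' lk] _] := clX N XN.
  by exists (exist _ N' XN').
have /choice[pv pvP] : forall s : S, exists s' : S, link (sval s') (sval s).
  move=> [N XN] /=; have [_ [N' XN' lk]] := clX N XN.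
  by exists (exist _ N' XN').
pose s0 : S := exist _ M XM.
(* Follow links to the right for [k >= 0] and to the left for [k < 0]. *)
pose Z (k : int) : lmodType R :=
  match k with
  | Posz n => sval (iter n nx s0)
  | Negz n => sval (iter n.+1 pv s0)
  end.
suff linkZ k : link (Z k) (Z (k + 1)) by exact: gproj_of_links linkZ.
case: k => [n | [|n]]; last 1 first.
- have -> : Negz n.+1 + 1 = Negz n by rewrite !NegzE -[n.+2]addn1 PoszD opprD
    subrK.
  exact: pvP.
- by have -> : Posz n + 1 = Posz n.+1; [rewrite -PoszD addn1 | exact: nxP].
- exact: pvP.
Qed.

Lemma link_ext_van Q n N M : projective Q ->
  link N M -> (forall k, (k < n)%N -> ext_van Q k N) -> ext_van Q n M.
Proof.
move=> pQ [P [i [p [pP ex ext]]]]; case: n => [_ | n XN].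
  by apply: ext_van0_proj ex (ext _ _).
by apply: ext_vanS ex (XN n _).
Qed.

(** The left orthogonal of the projective modules with respect to all higher
    Ext. *)
Definition proj_orth M : Prop := forall Q n, projective Q -> ext_van Q n M.

Lemma gproj_proj_orth M : gorenstein_projective M -> proj_orth M.
Proof.
move=> /gprojP[X clX XM] Q n pQ.
elim/ltn_ind: n M XM => n IH M XM; have [_ [N XN lk]] := clX M XM.
by apply: link_ext_van lk _ => // k kn; apply: IH.
Qed.

Lemma gproj_iso M M' (f : {linear M -> M'}) :
  injective f -> surj f -> gorenstein_projective M' -> gorenstein_projective M.
Proof.
move=> fi fs /gprojP[X clX XM]; apply/gprojP.
exists (fun N => exists N' (g : {linear N -> N'}),
  [/\ injective g, surj g & X N']).
  move=> N [N' [g [gi gs XN']]]; have [[N1 X1 l1] [N2 X2 l2]] := clX N' XN'.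
  split.
    exists N1; last exact: link_isol gi gs l1.
    by exists N1, idfun; split=> // x; exists x.
  exists N2; first by exists N2, idfun; split=> // x; exists x.
  have [|h hP] := lift_inj (f := idfun) gi; first exact: gs.
  apply: (link_isor (f := h)) l2.
    by move=> x y hxy; rewrite -[x]hP hxy hP.
  by move=> x; exists (g x); apply: gi; rewrite hP.
by exists M', f.
Qed.

Lemma zero_projective P : (forall x : P, x = 0) -> projective P.
Proof.
move=> P0 A B g f gs; exists \0 => x.
by rewrite linear0 (P0 x) linear0.
Qed.

Lemma rV0_zero (x : 'rV[R]_0) : x = 0.
Proof. by apply/rowP=> -[]. Qed.

Lemma proj_gproj P : projective P -> gorenstein_projective P.
Proof.
move=> pP; apply/gprojP; exists (fun N => projective N) => // N pN; split.
  exists ('rV[R]_0 : lmodType R); first by apply: zero_projective rV0_zero.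
  exists N, idfun, \0; split=> // [|Q _ u]; last by exists u.
  split=> // [y | x]; first by exists 0; rewrite (rV0_zero y).
  by split=> // _; exists x.
exists ('rV[R]_0 : lmodType R); first by apply: zero_projective rV0_zero.
exists N, \0, idfun; split=> // [|Q _ u]; last first.
  by exists \0 => x /=; rewrite (rV0_zero x) linear0.
split=> // [x y _ | y | x]; first by rewrite (rV0_zero x) (rV0_zero y).
  by exists y.
split=> [/= -> | [y <-] //]; by exists 0.
Qed.

Lemma prod_map_exists A B C D (f : {linear A -> C}) (g : {linear B -> D}) :
  exists h : {linear (A * B)%type -> (C * D)%type},
    forall x, h x = (f x.1, g x.2).
Proof.
pose f1 : {linear (A * B)%type -> C} := f \o fst.
by have [h hP] := copair_map_exists f1 (g \o snd); exists h.
Qed.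

Lemma ses_sum A B C A' B' C' (i : {linear A -> B}) (p : {linear B -> C})
    (i' : {linear A' -> B'}) (p' : {linear B' -> C'})
    (h : {linear (A * A')%type -> (B * B')%type})
    (q : {linear (B * B')%type -> (C * C')%type}) :
  ses i p -> ses i' p' -> (forall x, h x = (i x.1, i' x.2)) ->
  (forall x, q x = (p x.1, p' x.2)) -> ses h q.
Proof.
move=> [ii ps e] [ii' ps' e'] hP qP; split=> [[x x'] [y y'] | [y y'] | [x x']].
- by rewrite !hP => -[/ii-> /ii'->].
- have [x <-] := ps y; have [x' <-] := ps' y'.
  by exists (x, x'); rewrite qP.
- rewrite qP; split=> [[/e[y <-] /e'[y' <-]] | [[y y']]].
    by exists (y, y'); rewrite hP.
  by rewrite hP => -[<- <-]; congr (_, _);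
    [apply/e; exists y|apply/e'; exists y'].
Qed.

Lemma link_sum N M N' M' : link N M -> link N' M' ->
  link (N * N')%type (M * M')%type.
Proof.
move=> [P [i [p [pP ex ext]]]] [P' [i' [p' [pP' ex' ext']]]].
have [h hP] := prod_map_exists i i'; have [q qP] := prod_map_exists p p'.
exists (P * P')%type, h, q; split;
  [exact: proj_sum | exact: ses_sum ex ex' hP qP |].
move=> Q pQ u.
have [a aP] := inl_exists N N'.
have [b bP] := inr_exists N N'.
have [v vP] := ext Q pQ (u \o a); have [v' v'P] := ext' Q pQ (u \o b).
have [w wP] := pair_map_exists v v'; exists w => -[x x'].
rewrite hP wP /= vP v'P /= aP bP -linearD; congr (u _).
by congr (_, _); rewrite /= ?addr0 ?add0r.
Qed.

Lemma gproj_sum M M' : gorenstein_projective M -> gorenstein_projective M' ->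
  gorenstein_projective (M * M')%type.
Proof.
move=> /gprojP[X clX XM] /gprojP[X' clX' XM']; apply/gprojP.
exists (fun N => exists A B, [/\ N = (A * B)%type :> lmodType R, X A & X' B]).
  move=> _ [A [B [-> XA XB]]].
  have [[A1 X1 l1] [A2 X2 l2]] := clX A XA.
  have [[B1 Y1 m1] [B2 Y2 m2]] := clX' B XB.
  split; [exists (A1 * B1)%type | exists (A2 * B2)%type]; try exact: link_sum.
    by exists A1, B1.
  by exists A2, B2.
by exists M, M'.
Qed.

Lemma res0P M : has_gproj_resolution M 0 <-> gorenstein_projective M.
Proof.
split=> [[G [d [eps [gG zG es e0 e]]]] | gM].
  have [||g gP] := lift_inj (f := idfun) (i := eps); last 1 first.
  - apply: (gproj_iso (f := g)) (gG 0%N _) => // [x y gxy | x].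
      by rewrite -[x]gP gxy gP.
    have : eps (g (eps x) - x) = 0 by rewrite linearB /= gP subrr.
    move=> /e0[y]; rewrite (zG 1%N _ y) // linear0 => /esym/eqP.
    by rewrite subr_eq0 => /eqP; exists (eps x).
  - apply: linear_injP => x /e0[y <-].
    by rewrite (zG 1%N _ y) // linear0.
  - exact: es.
exists (fun k => if k is 0 then M else 'rV[R]_0 : lmodType R), (fun k => \0),
  idfun.
split=> [[|k] // | [|k] // _ x | y | x | k x].
- exact: rV0_zero.
- by exists y.
- by split=> [/= -> | [y <-] //]; exists 0.
- by split=> // _; exists 0; rewrite [RHS]rV0_zero.
Qed.

(** With [res0P], this makes resolutions inductive in their length. *)
Lemma resSP M n : has_gproj_resolution M n.+1 <->
  exists N G (i : {linear N -> G}) (p : {linear G -> M}),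
    [/\ ses i p, gorenstein_projective G & has_gproj_resolution N n].
Proof.
split=> [[G [d [eps [gG zG es e0 e]]]] | [N [G0 [i [p [ex gG0]]]]]].
  have [N [i ex]] := ses_kernel es; have [ii _ ei] := ex.
  have [|f fP] := lift_inj (f := d 0%N) ii.
    by move=> x; apply/ei/e0; exists x.
  exists N, (G 0%N), i, eps; split=> //; first exact: gG.
  exists (fun k => G k.+1), (fun k => d k.+1), f; split=> //.
  - by move=> k kn; apply: gG.
  - by move=> k kn; apply: zG.
  - move=> y; have /e0[x xP] : eps (i y) = 0 by apply/ei; exists y.
    by exists x; apply: ii; rewrite fP.
  - move=> x; rewrite -e -fP; split=> [-> |]; first by rewrite linear0.
    by rewrite -(linear0 i) => /ii.
case=> G [d [eps [gG zG es e0 e]]]; have [ii ps ei] := ex.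
pose G' k := if k is k'.+1 then G k' else G0.
pose d' k : {linear G' k.+1 -> G' k} :=
  match k with 0 => i \o eps | k'.+1 => d k' end.
exists G', d', p; split=> //.
- by case=> // k; apply: gG.
- by case=> // k; apply: zG.
- move=> x; rewrite ei /=; split=> [[y <-] | [y <-]]; last by exists (eps y).
  by have [z <-] := es y; exists z.
- case=> [x | k]; last exact: e.
  by rewrite -e0 /= -(linear0 i); split=> [/ii | ->].
Qed.

Lemma res_leq M n k : (n <= k)%N ->
  has_gproj_resolution M n -> has_gproj_resolution M k.
Proof.
move=> /subnK <-; elim: (k - n)%N => // j IH /IH {IH}; rewrite addSn.
elim: (j + n)%N M => {j n k} [|n IH] M; last first.
  move=> /resSP[N [G [i [p [ex gG rN]]]]]; apply/resSP.
  by exists N, G, i, p; split=> //; apply: IH.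
move=> /res0P gM; apply/resSP; exists ('rV[R]_0 : lmodType R), M, \0, idfun;
  split=> //.
  split=> // [x y _ | y | x]; first by rewrite (rV0_zero x) (rV0_zero y).
    by exists y.
  by split=> [/= -> | [y <-] //]; exists 0.
by apply/res0P/proj_gproj/zero_projective/rV0_zero.
Qed.

(** Gorenstein projective modules are acyclic for Ext into projectives, so a
    resolution of length [n] computes it and leaves nothing beyond degree
    [n]. *)
Lemma res_ext_van M n Q k : has_gproj_resolution M n -> projective Q ->
  (n <= k)%N -> ext_van Q k M.
Proof.
move=> rM pQ; elim: n M k rM => [|n IH] M k.
  by move=> /res0P/gproj_proj_orth gM _; apply: gM.
move=> /resSP[N [G [i [p [ex gG rN]]]]]; case: k => // k nk.
by apply: ext_van_coker ex _ _; [apply: IH | apply: gproj_proj_orth].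
Qed.

Lemma Gpd_leP M n : enat_le (Gpd M) (Some n) <-> has_gproj_resolution M n.
Proof.
rewrite /Gpd; case E: (least _) => [m|] /=; last first.
  by split=> // rM; have /least_NoneP/(_ n) := E.
have /least_SomeP[rm mn] := E; split=> [le | /mn //].
exact: res_leq le rm.
Qed.

(** * Modules orthogonal to the projectives *)

(** For modules without higher Ext into projectives the left half of a totally
    acyclic complex is any projective resolution; only the right half has to be
    provided. *)
Definition coresolving (X : lmodType R -> Prop) : Prop :=
  forall N, X N -> proj_orth N /\ exists2 N', X N' & link N N'.

(** The class together with all the modules of which an iterated cosyzygy lies
    in it. *)
Inductive reaches (X : lmodType R -> Prop) : lmodType R -> Prop :=
| reaches_base N : X N -> reaches X N
| reaches_step N N' : proj_orth N -> link N N' -> reaches X N' -> reaches X N.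

Lemma ses_link N P M (i : {linear N -> P}) (p : {linear P -> M}) :
  projective P -> ses i p -> proj_orth M -> link N M.
Proof.
move=> pP ex gM; exists P, i, p; split=> // Q pQ.
exact: (gM Q 0%N pQ) ex.
Qed.

Lemma coresolving_gproj X M : coresolving X -> X M -> gorenstein_projective M.
Proof.
move=> fX XM; apply/gprojP; exists (reaches X); last exact: reaches_base.
have gX N : reaches X N -> proj_orth N by case=> // {}N /fX[].
move=> N rN; split.
  case: rN => {}N.
    by move=> /fX[_ [N' XN' lk]]; exists N' => //; apply: reaches_base.
  by move=> N' _ lk rN'; exists N'.
have [N' [P [i [p [pP ex]]]]] := proj_ses_exists N.
have lk : link N' N := ses_link pP ex (gX N rN).
exists N' => //; apply: reaches_step lk (rN) => Q n pQ.
by apply: ext_van_kernel ex _ (gX N rN _ _ pQ); apply: proj_ext_van.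
Qed.

Lemma gproj_link M : gorenstein_projective M ->
  exists2 M', gorenstein_projective M' & link M M'.
Proof.
move=> /gprojP[X clX XM]; have [[M' XM' lk] _] := clX M XM.
by exists M' => //; apply/gprojP; exists X.
Qed.

Lemma proj_orth_ext : ext_closed proj_orth.
Proof. by move=> A B C i p ex gA gC Q n pQ;
  apply: ext_van_ext ex (gA _ _ pQ) (gC _ _ pQ). Qed.

(** Horseshoe lemma on the right: [B] embeds in [P * P1] with a cokernel that
    is an extension of [C'] by [A'], because the embedding of [A] in [P]
    extends to [B] by vanishing of Ext^1. *)
Lemma link_ext A B C A' C' (i : {linear A -> B}) (p : {linear B -> C}) :
  ses i p -> proj_orth B -> proj_orth C -> link A A' -> link C C' ->
    proj_orth A' -> proj_orth C' ->
  exists B' (i' : {linear A' -> B'}) (p' : {linear B' -> C'}),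
    ses i' p' /\ link B B'.
Proof.
move=> ex gB gC [P [j [q [pP exA ext]]]] [P1 [j1 [q1 [pP1 exC ext1]]]] gA' gC'.
have [ii ps e] := ex; have [ij qs eA] := exA; have [ij1 q1s eC] := exC.
(* Extend the embedding [j] of [A] to [B], using Ext^1(C, P) = 0. *)
have [f fP] := gC P 0%N pP _ _ _ _ ex j.
have [k kP] := copair_map_exists f (j1 \o p).
have ik : injective k.
  apply: linear_injP => b; rewrite kP => -[fb /=].
  rewrite -(linear0 j1) => /ij1/e[a ab]; rewrite -ab in fb *.
  by move: fb; rewrite fP -(linear0 j) => /ij ->; rewrite linear0.
have [B' [t [ts et]]] := coker_exists k.
have exB : ses k t by [].
have [a aP] := inl_exists P P1.
have [|i' i'P] := factor_surj (p := q) (f := t \o a) qs.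
  move=> x /eA[y <-]; apply/et; exists (i y).
  by rewrite kP fP /= aP (ses_comp0 ex) linear0.
have [|p' p'P] := factor_surj (p := t) (f := q1 \o snd) ts.
  by move=> x /et[b <-]; rewrite kP /= (ses_comp0 exC).
have exB' : ses i' p'.
  split=> [|z|y].
  - apply: linear_injP => x; have [y <-] := qs x.
    rewrite i'P => /et[b]; rewrite kP /= aP => -[fb /=].
    rewrite -(linear0 j1) => /ij1/e[z zb]; apply/eA; exists z.
    by rewrite -fP zb.
  - by have [x <-] := q1s z; exists (t (0, x)); rewrite p'P.
  - have [[x x1] <-] := ts y; rewrite p'P /=; split=> [/eC[c cx1] | [z]].
      have [b bc] := ps c; exists (q (x - f b)); rewrite i'P /=.
      apply/eqP; rewrite -subr_eq0 -linearB; apply/eqP/et; exists (- b).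
      rewrite linearN kP /= aP bc cx1; congr (_, _) => /=;
        last by rewrite sub0r.
      by rewrite addrC addrA addNr add0r.
    have [w <-] := qs z; rewrite i'P => /= tw; have := p'P (x, x1).
    by rewrite /= -tw p'P /= aP /= linear0 => <-.
exists B', i', p'; split=> //.
by apply: ses_link exB _; [exact: proj_sum | exact: proj_orth_ext exB' gA' gC'].
Qed.

Lemma gproj_ext : ext_closed (@gorenstein_projective R).
Proof.
move=> A B C i p ex gA gC.
apply: (@coresolving_gproj (fun B =>
  exists A C (i : {linear A -> B}) (p : {linear B -> C}),
   [/\ ses i p, gorenstein_projective A & gorenstein_projective C]));
     last first.
  by exists A, C, i, p.
move=> {A C i p ex gA gC}B [A [C [i [p [ex gA gC]]]]].
have cB : proj_orth B by apply: proj_orth_ext ex _ _; apply: gproj_proj_orth.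
split=> //; have [A' gA' lA] := gproj_link gA;
  have [C' gC' lC] := gproj_link gC.
have [//|||B' [i' [p' [ex' lB]]]] := link_ext ex cB _ lA lC;
  try exact: gproj_proj_orth.
by exists B' => //; exists A', C', i', p'.
Qed.

Fixpoint pd_le (n : nat) M : Prop :=
  match n with
  | 0 => projective M
  | n.+1 => exists N P (i : {linear N -> P}) (p : {linear P -> M}),
      [/\ ses i p, projective P & pd_le n N]
  end.

(** The last syzygy in a finite projective resolution is projective, so the
    vanishing of Ext^1 into it splits off the end of the resolution. *)
Lemma proj_orth_pd_proj M n : proj_orth M -> pd_le n M -> projective M.
Proof.
elim: n M => // n IH M gM [N [P [i [p [ex pP pN]]]]].
have gN : proj_orth N.
  by move=> Q k pQ; apply: ext_van_kernel ex _ (gM _ _ pQ); apply: proj_ext_van.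
(* The identity of [N] extends to [P], so that [M] is a retract of [P]. *)
have projN := IH N gN pN.
have [r rP] := gM N 0%N projN _ _ _ _ ex idfun.
have [ii ps e] := ex.
have [d dP] := sub_map_exists idfun (i \o r).
have [|s sP] := factor_surj (f := d) ps.
  by move=> x /e[y <-]; rewrite dP /= rP subrr.
apply: (proj_retract (a := s) (r := p)) pP => x; have [y <-] := ps x.
by rewrite sP dP linearB /= (ses_comp0 ex) subr0.
Qed.

(** The pushout of [j] and [i], as the cokernel of [(j, - i)]. *)
Lemma ses_pushout N G M H (i : {linear N -> G}) (p : {linear G -> M})
    (j : {linear N -> H}) :
  ses i p ->
  exists Y (a : {linear H -> Y}) (b : {linear G -> Y}) (c : {linear Y -> M}),
    [/\ ses a c, forall g, c (b g) = p g, forall n, a (j n) = b (i n),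
        forall y, exists h g, y = a h + b g
      & forall h g, a h + b g = 0 -> exists n, h = j n /\ g = - i n].
Proof.
move=> ex; have [ii ps e] := ex.
have [m mP] := copair_map_exists j (\- i).
have [Y [t [ts et]]] := coker_exists m.
have [x0 x0P] := inl_exists H G.
have [y0 y0P] := inr_exists H G.
have tE h g : t (x0 h) + t (y0 g) = t (h, g).
  by rewrite -linearD x0P y0P; congr (t (_, _)); rewrite /= ?addr0 ?add0r.
have [|c cP] := factor_surj (p := t) (f := p \o snd) ts.
  by move=> x /et[n <-]; rewrite mP /= linearN /= (ses_comp0 ex) oppr0.
have univ h g : t (h, g) = 0 -> exists n, h = j n /\ g = - i n.
  by move=> /et[n]; rewrite mP => -[<- <-]; exists n.
exists Y, (t \o x0), (t \o y0), c; split=> [|g|n|y|h g] /=.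
- split=> [|x|y].
  + apply: linear_injP => h /=; rewrite x0P => /univ[n [/= -> /esym/eqP]].
    rewrite /= oppr_eq0 -(linear0 i) => /eqP/ii ->.
    exact: linear0.
  + by have [g <-] := ps x; exists (t (0, g)); rewrite cP.
  + have [[h g] <-] := ts y; rewrite cP /= -tE; split=> [/e[n ng] | [h' h'P]].
      exists (h + j n); rewrite /= linearD linearD; congr (_ + _).
      apply/eqP; rewrite -subr_eq0 -linearB; apply/eqP/et; exists n.
      by rewrite mP x0P y0P; congr (_, _) => /=; rewrite ?subr0 ?sub0r ?ng.
    have : c (t (x0 h')) = 0 by rewrite cP x0P /= linear0.
    by rewrite h'P linearD !cP x0P y0P /= linear0 add0r.
- by rewrite cP y0P.
- apply/eqP; rewrite -subr_eq0 -linearB; apply/eqP/et; exists n.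
  by rewrite mP x0P y0P; congr (_, _) => /=; rewrite ?subr0 ?sub0r.
- by have [[h g] <-] := ts y; exists h, g; rewrite tE.
- by rewrite tE; apply: univ.
Qed.

(** Auslander-Buchweitz approximation. If [M = G / N] and [N] embeds in [H]
    with Gorenstein projective cokernel, the pushout [Y] of [H] and [G] under
    [N] is an extension of Gorenstein projective modules, hence embeds in a
    projective module [P] with Gorenstein projective cokernel; then [M = Y / H]
    embeds in [P / H]. *)
Lemma gproj_hull M n : has_gproj_resolution M n ->
  exists H G' (i : {linear M -> H}) (p : {linear H -> G'}),
    [/\ ses i p, pd_le n H & gorenstein_projective G'].
Proof.
elim: n M => [|n IH] M.
  move=> /res0P/gproj_link[M' gM' [P [i [p [pP ex _]]]]].
  by exists P, M', i, p.
move=> /resSP[N [G [i [p [ex gG rN]]]]].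
have [H [G' [j [q [exH pdH gG']]]]] := IH N rN.
have [ii ps e] := ex; have [ij qs eH] := exH.
have [Y [a [b [c [exY cb ab gen univ]]]]] := ses_pushout j ex.
have [ia cs eY] := exY.
have bi : injective b.
  apply: linear_injP => g bg; have [|m [/esym jn ->]] := univ 0 g.
    by rewrite linear0 bg addr0.
  by move: jn; rewrite -(linear0 j) => /ij ->; rewrite linear0 oppr0.
have [s sP] := pair_map_exists a b.
have ss : surj s by move=> y; have [h [g ->]] := gen y; exists (h, g);
  rewrite sP.
have [|d dP] := factor_surj (p := s) (f := q \o fst) ss.
  by move=> [h g]; rewrite sP /= => /univ[m [-> _]]; rewrite (ses_comp0 exH).
have db g : d (b g) = 0 by have := dP (0, g); rewrite sP /= !linear0 add0r.
have da h : d (a h) = q h by have := dP (h, 0); rewrite sP /= linear0 addr0.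
have exG : ses b d.
  split=> // [x | y]; first by have [h <-] := qs x; exists (a h); rewrite da.
  split=> [|[g <-] //]; have [h [g ->]] := gen y.
  rewrite linearD db da addr0 => /eH[m <-]; exists (i m + g).
  by rewrite linearD ab.
have gY : gorenstein_projective Y := gproj_ext exG gG gG'.
have [Y' gY' [P [k [r [pP exP _]]]]] := gproj_link gY.
have [ik rs eP] := exP.
have [D [u [us eu]]] := coker_exists (k \o a).
have [|v vP] := factor_surj (p := c) (f := u \o k) cs.
  by move=> y /eY[h <-]; apply/eu; exists h.
have [|w wP] := factor_surj (p := u) (f := r) us.
  by move=> x /eu[h <-]; rewrite /= (ses_comp0 exP).
exists D, Y', v, w; split=> //; last first.
  exists H, P, (k \o a), u; split=> //; split=> //.
  by move=> x y /= /ik/ia.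
split=> [|x|x].
- apply: linear_injP => x; have [y <-] := cs x;
    rewrite vP /= => /eu[h /= /ik <-].
  exact: ses_comp0 exY h.
- by have [z <-] := rs x; exists (u z); rewrite wP.
- have [z <-] := us x; rewrite wP; split=> [/eP[y <-] | [m mz]].
    by exists (c y); rewrite vP.
  have [y ym] := cs m; rewrite -ym vP /= in mz.
  have /eu[h /= hP] : u (z - k y) = 0 by rewrite linearB /= mz subrr.
  by rewrite -(subrK (k y) z) -hP linearD !(ses_comp0 exP) addr0.
Qed.

(** In the hull of [M] the finite projective dimension and the vanishing of Ext
    force the middle term to be projective, so that [M] is a syzygy of a
    Gorenstein projective module. *)
Lemma proj_orth_gproj M n : has_gproj_resolution M n -> proj_orth M ->
  gorenstein_projective M.
Proof.
move=> /gproj_hull[H [G' [i [p [ex pdH gG']]]]] gM.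
have gH : proj_orth H by apply: proj_orth_ext ex gM (gproj_proj_orth gG').
have pH := proj_orth_pd_proj gH pdH.
apply: (@coresolving_gproj (fun N => N = M \/ gorenstein_projective N));
  last by left.
move=> N [-> | gN].
  split=> //; exists G'; first by right.
  exact: ses_link ex (gproj_proj_orth gG').
split; first exact: gproj_proj_orth.
by have [N' gN' lk] := gproj_link gN; exists N' => //; right.
Qed.

Lemma ext_van_res M n : (forall N, proj_orth N -> gorenstein_projective N) ->
  (forall Q k, projective Q -> (n <= k)%N -> ext_van Q k M) ->
  has_gproj_resolution M n.
Proof.
move=> gp; elim: n M => [|n IH] M XM.
  by apply/res0P/gp => Q k pQ; apply: XM.
have [N [P [i [p [pP ex]]]]] := proj_ses_exists M.
apply/resSP; exists N, P, i, p; split=> //; first exact: proj_gproj.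
by apply: IH => Q k pQ nk; apply: (XM Q k.+1) ex.
Qed.

End GorensteinProjective.

(** * Reduction of Ext vanishing to cyclic modules *)

Section Filtration.
Variables (R : comPzRingType) (Q : lmodType R).
Implicit Types A B : lmodType R.
Implicit Types C D G H M N P U W Y Z : lmodType R.

(** The subquotient [A / B] of [Z] has vanishing Ext^[n+1] into [Q]. The
    subquotient is given up to isomorphism, by a surjection from a copy of
    [A]. *)
Definition factor_van n Z (A B : Z -> Prop) : Prop :=
  exists U C (i : {linear U -> Z}) (q : {linear U -> C}),
    [/\ injective i /\ (forall z, A z <-> exists u, i u = z),
        surj q, forall u, q u = 0 <-> B (i u) & ext_van Q n C].

(** A map given on the preimage of [B] extends to the preimage of [A] when
    Ext^1 from [A / B] to [Q] vanishes. Maps on submodules of [P] are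
    represented by functions on [P] that are linear there, with arbitrary
    values elsewhere. *)
Lemma factor_van_extends Z N P (A B : Z -> Prop) (i : {linear N -> P})
    (p : {linear P -> Z}) (v : P -> Q) :
  surj p -> submodule A -> submodule B -> (forall z, B z -> A z) ->
  factor_van 0 A B ->
  (forall a x y, B (p x) -> B (p y) -> v (a *: x + y) = a *: v x + v y) ->
  exists v' : P -> Q,
    (forall a x y, A (p x) -> A (p y) -> v' (a *: x + y) = a *: v' x + v' y)
    /\ forall x, B (p x) -> v' x = v x.
Proof.
move=> ps sA sB BA [U [C [k [q [[ik imk] qs kq XC]]]]] vlin.
have [|V [m [im mP]]] := sub_exists (S := fun x => A (p x)).
  split=> [|a x y Ax Ay]; first by rewrite linear0; case: sA.
  by rewrite linearP; apply: sA.2.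
have Am w : A (p (m w)) by apply/mP; exists w.
have [|r rP] := lift_inj (f := p \o m) ik; first by move=> w; apply/imk/Am.
have rs : surj r.
  move=> u; have [x xP] := ps (k u).
  have /mP[w wP] : A (p x) by rewrite xP; apply/imk; exists u.
  by exists w; apply: ik; rewrite rP /= wP.
have [K [l exl]] := ses_kernel (surj_comp rs qs).
have [il _ el] := exl.
have BK w : q (r w) = 0 <-> B (p (m w)) by rewrite kq rP.
have lin : linear (fun w => v (m (l w))).
  move=> a x y; rewrite !linearP vlin //; apply/BK; exact: (ses_comp0 exl).
have [v0 v0P] := linear_map_of lin.
have [v1 v1P] := XC _ _ _ _ exl v0.
have /choice[v' v'P] : forall x, exists y, A (p x) -> exists2 w,
  m w = x & y = v1 w.
  move=> x; have [/mP[w wP] | nA] := pselect (A (p x)).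
    by exists (v1 w) => _; exists w.
  by exists 0.
exists v'; split=> [a x y Ax Ay | x Bx].
  have [w wx ->] := v'P x Ax; have [w' wy ->] := v'P y Ay.
  have [|w'' wxy ->] := v'P (a *: x + y); first by rewrite linearP; apply: sA.2.
  rewrite -linearP; congr (v1 _); apply: im.
  by rewrite wxy linearP wx wy.
have [w wx ->] := v'P x (BA _ Bx).
have /el[t tw] : (q \o r) w = 0 by apply/BK; rewrite wx.
by rewrite -tw v1P v0P tw wx.
Qed.

Section FreeStep.
Variables (Z N P : lmodType R) (c : {linear P -> (Z -> R^o)}) (e : Z -> P).
Hypothesis freeP : free_on (fun z => z <> 0) c e.
Variables (p : {linear P -> Z}) (i : {linear N -> P}).
Hypothesis pe : forall z, z <> 0 -> p (e z) = z.
Hypothesis exP : ses i p.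

(** The part of the syzygy [N] of [Z] that comes from the free module on [A]. *)
Definition supp_in (A : Z -> Prop) (x : N) : Prop :=
  forall z, ~ A z -> c (i x) z = 0.

Lemma supp_in_submodule (A : Z -> Prop) : submodule (supp_in A).
Proof.
split=> [|a x y xA yA] z Az; first by rewrite !linear0.
by rewrite !linearP -[LHS]/(a * c (i x) z + c (i y) z) xA // yA // mulr0 addr0.
Qed.

(** The free cover of [Z] on its nonzero elements is functorial in submodules:
    the syzygies of [A] and [B] inside it have as quotient the syzygy of [A /
    B] with respect to the free module on [A \ B]. The quotient map restricts
    coordinates to [A \ B]. *)
Lemma factor_van_syz n (A B : Z -> Prop) :
  submodule A -> submodule B -> (forall z, B z -> A z) ->
  factor_van n.+1 A B -> factor_van n (supp_in A) (supp_in B).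
Proof.
move=> sA sB BA [U [C [k [q [[ik imk] qs kq XC]]]]].
pose D z := A z /\ ~ B z.
have Dn0 z : D z -> z <> 0 by move=> [_ Bz] z0; apply: Bz; rewrite z0; case: sB.
have [PD [cD [eD freeD]]] := free_exists R D.
have [ic fin c0 ce] := freeP; have [icD finD cD0 ceD] := freeD.
(* [a] inverts the copy [U] of [A]; [th] computes the class of a vector
   supported in [A], and [rho] is the restriction of coordinates to [D]. *)
have /choice[a aP] : forall z, exists u, A z -> k u = z.
  by move=> z; have [/imk[u uP] | nA] := pselect (A z); [exists u | exists 0].
have [pD pDe] := free_lift_gen freeD (q \o a).
have [th thP] := free_lift_gen freeP (fun z => if `[< A z >] then a z else 0).
have [rho rhoP] := free_lift_gen freeP
  (fun z => if `[< D z >] then eD z else 0).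
have [la laP] := free_lift_gen freeD e.
have kth x : (forall z, ~ A z -> c x z = 0) -> k (th x) = p x.
  move: x; apply: (free_gen_ext_on freeP (f := k \o th)) => z z0 Az /=.
  by rewrite thP // (asboolT Az) aP // pe.
have qth x : (forall z, ~ A z -> c x z = 0) -> q (th x) = pD (rho x).
  move: x; apply: (free_gen_ext_on freeP (f := q \o th) (g := pD \o rho)) =>
    z z0 Az /=.
  rewrite thP // (asboolT Az) rhoP //; case: asboolP => Dz;
    first by rewrite pDe.
  rewrite linear0; apply/kq; rewrite aP //.
  by have [//|Bz] := pselect (B z); case: Dz.
have crho x z : cD (rho x) z = if `[< D z >] then c x z else 0.
  have lin : linear (fun (x : P) (z : Z) =>
    if `[< D z >] then c x z else (0 : R^o)).
    move=> b x1 y; apply: funext => w; rewrite linearP.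
    rewrite -[RHS]/(b * (if `[< D w >] then c x1 w else 0) +
      (if `[< D w >] then c y w else 0)).
    by case: asboolP => _; rewrite ?mulr0 ?addr0.
  have [m mP] := linear_map_of lin.
  rewrite -[RHS]/((fun z => if `[< D z >] then c x z else (0 : R^o)) z) -mP.
  congr (_ z); rewrite -[LHS]/((cD \o rho) x); move: x {z}.
  apply: (free_gen_ext freeP) => w w0; rewrite mP /= rhoP //;
    apply: funext => z.
  rewrite ce //; case: (asboolP (D w)) => Dw.
    rewrite ceD //; case: eqVneq => [<-|]; first by rewrite asboolT.
    by case: ifP.
  rewrite linear0; case: eqVneq => [<-|]; first by rewrite asboolF.
  by case: ifP.
have cla x : c (la x) = cD x.
  move: x; apply: (free_gen_ext freeD (f := c \o la)) => w Dw /=.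
  rewrite laP //; apply: funext => z.
  by rewrite ce ?ceD //; apply: Dn0.
have rhola x : rho (la x) = x.
  move: x; apply: (free_gen_ext freeD (f := rho \o la) (g := idfun)) => w Dw /=.
  by rewrite laP // rhoP ?asboolT //; apply: Dn0.
have pDs : surj pD.
  move=> y; have [u uy] := qs y; have [Bu | Bu] := pselect (B (k u)).
    by exists 0; rewrite linear0 -uy; apply/esym/kq.
  have Au : A (k u) by apply/imk; exists u.
  exists (eD (k u)); rewrite pDe //= -uy; congr (q _); apply: ik.
  by rewrite aP.
have [ND [iD exD]] := ses_kernel pDs.
have XN : ext_van Q n ND := XC _ _ _ _ (free_projective freeD) exD.
have [iiD _ eiD] := exD; have [ii ps ei] := exP.
have [U' [k' [ik' imk']]] := sub_exists (supp_in_submodule A).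
have Ak' u : supp_in A (k' u) by apply/imk'; exists u.
have [|si siP] := lift_inj (f := rho \o i \o k') iiD.
  move=> u; apply/eiD; rewrite /= -qth; last exact: Ak'.
  have -> : th (i (k' u)) = 0; last by rewrite linear0.
  apply: ik; rewrite linear0 kth; last exact: Ak'.
  exact: ses_comp0 exP _.
exists U', ND, k', si; split=> // [y | u].
  pose g := iD y; have pg : pD g = 0 by exact: ses_comp0 exD y.
  have lgA z : ~ A z -> c (la g) z = 0.
    by move=> Az; rewrite cla cD0 // => -[].
  pose b := p (la g).
  have Bb : B b by rewrite /b -kth // -kq qth // rhola.
  (* A vector over [b] supported in [B]: it corrects [la g], which lies over
     [b], to an element of the syzygy. For [b = 0] there is no generator. *)
  have [t [pt ct rt]] : exists t,
    [/\ p t = b, forall z, ~ A z -> c t z = 0 & rho t = 0].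
    have [b0 | b0] := eqVneq b 0.
      by exists 0; rewrite !linear0 b0; split=> // z _; rewrite linear0.
    exists (e b); split; first by apply: pe; apply/eqP.
      move=> z Az; rewrite ce; last exact/eqP.
      by case: eqVneq => // bz; case: Az; rewrite -bz; apply: BA.
    by rewrite rhoP; [rewrite asboolF // => -[] | apply/eqP].
  have /ei[x xP] : p (la g - t) = 0 by rewrite linearB /= pt subrr.
  have /imk'[u uP] : supp_in A x.
    by move=> z Az; rewrite xP linearB -[LHS]/(c (la g) z - c t z) lgA // ct //
      subrr.
  exists u; apply: iiD; rewrite siP /= uP xP linearB /= rhola rt.
  by rewrite subr0.
have -> : si u = 0 <-> rho (i (k' u)) = 0.
  rewrite -[rho _](siP u); split=> [-> | ]; first by rewrite linear0.
  by rewrite -(linear0 iD) => /iiD.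
split=> [r0 z Bz | Bu].
  have [Az | Az] := pselect (A z); last exact: Ak'.
  by have := crho (i (k' u)) z; rewrite r0 linear0 asboolT // => <-.
apply: icD; rewrite linear0; apply: funext => z; rewrite crho.
by case: asboolP => // -[_ /Bu].
Qed.

End FreeStep.

Section Chains.
Variables (J : Type) (le : J -> J -> Prop).
Hypothesis le_refl : forall j, le j j.
Hypothesis le_trans : forall j k l, le j k -> le k l -> le j l.

Definition is_chain (S : J -> Prop) : Prop :=
  (exists j, S j) /\ forall j k, S j -> S k -> le j k \/ le k j.

(** The index type is fixed, so that a filtration of a module by submodules can
    be transported to its syzygies. Strict successors with acyclic quotients
    play the role of successor ordinals, and upper bounds of chains that of
    limits. *)
Definition filtered n Z (F : J -> Z -> Prop) : Prop :=
  [/\ (forall j, submodule (F j)) /\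
    (forall j k, le j k -> forall z, F j z -> F k z),
      exists j, factor_van n (F j) (fun z => z = 0),
      forall S, is_chain S -> exists s, (forall j, S j -> le j s) /\
        forall z, F s z -> exists2 j, S j & F j z
    & forall j, (forall z, F j z) \/
        exists k, [/\ le j k, ~ le k j & factor_van n (F k) (F j)]].

Lemma zero_submodule Z : submodule (fun z : Z => z = 0).
Proof. by split=> // a x y -> ->; rewrite scaler0 addr0. Qed.

(** Eklof's lemma: by Zorn's lemma there is a maximal stage together with an
    extension of the given map to it, and a stage with a successor is not
    maximal. *)
Lemma filtered_ext_van0 Z (F : J -> Z -> Prop) : filtered 0 F -> ext_van Q 0 Z.
Proof.
move=> [[sF mF] [j0 fac0] chain step] N P i p ex u.
have [ii ps e] := ex.
(* The extensions of [u] to preimages of stages. They are total functions, so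
   the order compares only their values on the preimage of the smaller
   stage. *)
pose T := {t : J * (P -> Q) |
  (forall a x y, F t.1 (p x) -> F t.1 (p y) -> t.2 (a *: x + y) = a *:
    t.2 x + t.2 y)
  /\ forall n, t.2 (i n) = u n}.
pose jj (t : T) := (sval t).1; pose vv (t : T) := (sval t).2.
pose Rel (t t' : T) : bool :=
  `[< le (jj t) (jj t') /\ forall x, F (jj t) (p x) -> vv t' x = vv t x >].
have vlin (t : T) a x y : F (jj t) (p x) -> F (jj t) (p y) ->
    vv t (a *: x + y) = a *: vv t x + vv t y := (svalP t).1 a x y.
have vi (t : T) n : vv t (i n) = u n := (svalP t).2 n.
have [t0] : inhabited T.
  have /choice[v vP] : forall x, exists y, p x = 0 -> exists2 n,
    i n = x & y = u n.
    move=> x; have [/e[n nP] | p0] := pselect (p x = 0).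
      by exists (u n) => _; exists n.
    by exists 0.
  have vi' n : v (i n) = u n.
    have [m mn ->] := vP _ (ses_comp0 ex n); congr (u _); exact: ii.
  have [v' [v'lin v'v]] : exists v' : P -> Q,
      (forall a x y, F j0 (p x) -> F j0 (p y) -> v' (a *: x + y) = a *:
        v' x + v' y)
      /\ forall x, p x = 0 -> v' x = v x.
    apply: (factor_van_extends i ps (sF j0) (zero_submodule Z) _ fac0).
      by move=> z ->; case: (sF j0).
    move=> a x y /e[n <-] /e[m <-]; rewrite -linearP !vi'.
    by rewrite linearP.
  constructor; exists (j0, v'); split=> //= n.
  by rewrite v'v ?vi' // (ses_comp0 ex).
have [|r s t /asboolP[rs rsv] /asboolP[st stv]|S Stot|t tmax] :=
  ZL_preorder t0 (R := Rel).
- by move=> t; apply/asboolP.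
- apply/asboolP; split=> [|x xr]; first exact: le_trans rs st.
  by rewrite stv ?rsv //; apply: mF xr.
- have [[t1 St1] | S0] := pselect (exists t, S t); last first.
    by exists t0 => s Ss; case: S0; exists s.
  have [|s [ub un]] := chain (fun j => exists2 t, S t & jj t = j).
    split=> [|_ _ [t St <-] [t' St' <-]]; first by exists (jj t1), t1.
    by have [/asboolP[? _]|/asboolP[? _]] := Stot t t' St St'; [left|right].
  have compat t t' x : S t -> S t' -> F (jj t) (p x) -> F (jj t') (p x) ->
      vv t x = vv t' x.
    move=> St St' tx t'x.
    by have [/asboolP[_ h]|/asboolP[_ h]] := Stot t t' St St'; rewrite h.
  have /choice[v vP] : forall x, exists y, forall t, S t -> F (jj t) (p x) ->
    y = vv t x.
    move=> x; have [[t St tx] | nt] :=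
      pselect (exists2 t, S t & F (jj t) (p x)).
      by exists (vv t x) => t' St' t'x; apply: compat.
    by exists 0 => t St tx; case: nt; exists t.
  have get x : F s (p x) -> exists2 t, S t & F (jj t) (p x).
    by move=> /un[_ [t St <-] tx]; exists t.
  have vs : (forall a x y, F s (p x) -> F s (p y) -> v (a *: x + y) = a *:
    v x + v y)
      /\ forall n, v (i n) = u n.
    split=> [a x y /get[t St tx] /get[t' St' t'y] | n]; last first.
      rewrite (vP (i n) t1) // (ses_comp0 ex); first by case: (sF (jj t1)).
    have [t2 St2 [t2x t2y]] : exists2 t2, S t2 & F (jj t2) (p x) /\
      F (jj t2) (p y).
      have [/asboolP[h _]|/asboolP[h _]] := Stot t t' St St'.
        by exists t' => //; split=> //; apply: mF tx.
      by exists t => //; split=> //; apply: mF t'y.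
    rewrite (vP x t2) // (vP y t2) // (vP _ t2) //; first exact: vlin.
    by rewrite linearP; apply: (sF _).2.
  exists (exist _ (s, v) vs) => t St; apply/asboolP; split=> [|x tx].
    by apply: ub; exists t.
  exact: vP.
- have [all | [k [jk nkj fac]]] := step (jj t).
    have lin : linear (vv t) by move=> a x y; apply: vlin.
    have [v vP] := linear_map_of lin; exists v => x.
    by rewrite vP vi.
  have [v' [v'lin v'v]] := factor_van_extends i ps (sF k) (sF (jj t))
    (mF _ _ jk) fac (vlin t).
  have v'P : (forall a x y, F k (p x) -> F k (p y) -> v' (a *: x + y) = a *:
    v' x + v' y)
      /\ forall n, v' (i n) = u n.
    split=> // n; rewrite v'v ?vi // (ses_comp0 ex).
    by case: (sF (jj t)).
  have /tmax/asboolP[/= kj _] : Rel t (exist _ (k, v') v'P).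
    by apply/asboolP; split.
  by case: nkj.
Qed.

Lemma filtered_ext_van n Z (F : J -> Z -> Prop) : filtered n F -> ext_van Q n Z.
Proof.
elim: n Z F => [|n IH] Z F; first exact: filtered_ext_van0.
move=> [[sF mF] [j0 fac0] chain step].
have [P [c [e freeP]]] := free_exists R (fun z : Z => z <> 0).
have [p pe] := free_lift_gen freeP (@id Z).
have ps : surj p.
  move=> z; have [-> | /eqP z0] := eqVneq z 0; first by exists 0;
    rewrite linear0.
  by exists (e z); rewrite pe.
have [N [i exP]] := ses_kernel ps.
apply: (ext_vanS (free_projective freeP) exP).
have [ii _ _] := exP; have [ic fin c0 _] := freeP.
apply: (IH N (fun j => supp_in c i (F j))); split.
- split=> [j | j k jk x xj z nk]; first exact: supp_in_submodule.
  by apply: xj => jz; apply: nk; apply: mF jz.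
- exists j0; have [|U [C [k [q [imk qs kq XC]]]]] :=
    factor_van_syz freeP pe exP (sF j0) (zero_submodule Z) _ fac0.
    by move=> z ->; case: (sF j0).
  exists U, C, k, q; split=> // u; rewrite kq; split=> [k0 | -> z _];
    last first.
    by rewrite !linear0.
  apply: ii; rewrite linear0; apply: ic; rewrite linear0; apply: funext => z.
  by have [z0 | z0] := eqVneq z 0;
    [apply: c0; rewrite z0 | apply: k0; apply/eqP].
- move=> S chS; have [s [ub un]] := chain S chS; exists s; split=> // x xs.
  have [t [_ tP]] := fin (i x); have [[j1 Sj1] tot] := chS.
  suff [j Sj jP] : exists2 j, S j & forall z, z \in t -> F s z -> F j z.
    exists j => // z nj; have [zt | /tP //] := boolP (z \in t).
    by apply: xs => sz; apply: nj; apply: jP.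
  elim: t {tP} => [|z t [j Sj jP]]; first by exists j1.
  have [sz | nsz] := pselect (F s z); last first.
    by exists j => // w; rewrite inE => /predU1P[-> // | wt]; apply: jP.
  have [j' Sj' j'z] := un z sz.
  have [l Sl [jl j'l]] : exists2 l, S l & le j l /\ le j' l.
    by have [h | h] := tot j j' Sj Sj'; [exists j' | exists j].
  exists l => // w; rewrite inE => /predU1P[-> _ | wt sw]; first exact: mF j'z.
  by apply: mF jl _ (jP _ wt sw).
- move=> j; have [all | [k [jk nkj fac]]] := step j.
    by left=> x z [].
  right; exists k; split=> //.
  exact (factor_van_syz freeP pe exP (sF k) (sF j) (mF j k jk) fac).
Qed.

End Chains.

(** Apply [filtered_ext_van] to the filtration of [M] by all its submodules;
    adding one element to a submodule gives a cyclic quotient. *)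
Lemma cyclic_ext_van n M :
  (forall C (f : {linear R^o -> C}), surj f -> ext_van Q n C) -> ext_van Q n M.
Proof.
move=> cyc; pose J := {A : M -> Prop | submodule A}.
pose le (A B : J) := forall x, sval A x -> sval B x.
have lexx (A : J) : le A A by [].
have le_trans (A B C : J) : le A B -> le B C -> le A C by move=> AB BC x /AB/BC.
suff : filtered le n (fun A : J => sval A) by exact: filtered_ext_van.
split.
- by split=> [A | A B AB //]; apply: svalP.
- exists (exist _ _ (zero_submodule M)) => /=.
  have [U [k [ik imk]]] := sub_exists (zero_submodule M).
  exists U, U, k, idfun; split=> // [u | u |].
  + by exists u.
  + by rewrite /= -(linear0 k); split=> [-> | /ik].
  + apply: proj_ext_van; apply: zero_projective => x.
    by apply: ik; rewrite linear0; apply/imk; exists x.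
- move=> S [[A SA] tot].
  have sub : submodule (fun x => exists2 B : J, S B & sval B x).
    split=> [|a x y [B SB Bx] [C SC Cy]].
      by exists A => //; case: (svalP A).
    have [h | h] := tot B C SB SC.
      by exists C => //; apply: (svalP C).2 => //; apply: h.
    by exists B => //; apply: (svalP B).2 => //; apply: h.
  exists (exist _ _ sub); split=> [B SB x Bx | x //].
  by exists B.
- move=> [A sA] /=; have [all | nall] := pselect (forall z, A z); first by left.
  right; have [x nAx] : exists x, ~ A x by apply/existsNP.
  have sB : submodule (fun y => exists r a, A a /\ y = a + r *: x).
    split=> [|a _ _ [r [b [Ab ->]]] [r' [b' [Ab' ->]]]].
      by exists 0, 0; rewrite scale0r addr0; split=> //; case: sA.
    exists (a * r + r'), (a *: b + b'); split; first exact: sA.2.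
    by rewrite scalerDr scalerDl scalerA addrACA.
  have AB y : A y -> exists r a, A a /\ y = a + r *: x.
    by move=> Ay; exists 0, y; rewrite scale0r addr0.
  exists (exist _ _ sB); split=> [y /AB // | BA |].
    apply: nAx; apply: BA => /=; exists 1, 0; rewrite scale1r add0r.
    by split=> //; case: sA.
  have [U [k [ik imk]]] := sub_exists sB.
  have [|C [q [qs qK]]] := @quot_exists R U (fun u => A (k u)).
    split=> [|a u w Au Aw]; first by rewrite linear0; case: sA.
    by rewrite linearP; apply: sA.2.
  exists U, C, k, q; split=> //.
  have /imk[ux uxP] : exists r a, A a /\ x = a + r *: x.
    by exists 1, 0; rewrite scale1r add0r; split=> //; case: sA.
  have [f fP] := line_exists (q ux); apply: (cyc C f) => y.
  have [u <-] := qs y; have /imk[r [a [Aa ua]]] : exists w,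
    k w = k u by exists u.
  exists r; rewrite fP; apply/eqP; rewrite -linearZ -subr_eq0 -linearB;
    apply/eqP/qK.
  rewrite linearB linearZ /= uxP ua opprD addrCA subrr addr0 -scaleN1r
    -[_ *: a]addr0.
  by apply: sA.2 => //; case: sA.
Qed.

End Filtration.

(** * Change of rings along a direct factor *)

Section LmoduleOf.
Variables (T : comPzRingType) (V : zmodType) (sc : T -> V -> V).
Hypotheses (scA : forall a b x, sc a (sc b x) = sc (a * b) x)
  (sc1 : left_id 1 sc) (scDr : right_distributive sc +%R)
  (scDl : forall x, {morph sc^~ x : a b / a + b}).

(** The carrier is [V]; the vacuous dependence on the scaling and its laws lets
    the module structure be attached to this type. *)
Definition lmodule_of : Type := (fun _ _ _ _ => V : Type) scA sc1 scDr scDl.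
HB.instance Definition _ := GRing.Zmodule.copy lmodule_of V.
HB.instance Definition _ := GRing.Zmodule_isLmodule.Build T lmodule_of
  scA sc1 scDr scDl.

End LmoduleOf.

Section Restriction.
Variables (T U : comPzRingType) (p : {rmorphism T -> U}) (N : lmodType U).

Definition restrict_scale t (x : N) : N := p t *: x.

Fact restrict_scaleA t t' x :
  restrict_scale t (restrict_scale t' x) = restrict_scale (t * t') x.
Proof. by rewrite /restrict_scale scalerA rmorphM. Qed.

Fact restrict_scale1 : left_id 1 restrict_scale.
Proof. by move=> x; rewrite /restrict_scale rmorph1 scale1r. Qed.

Fact restrict_scaleDr : right_distributive restrict_scale +%R.
Proof. by move=> t x y; rewrite /restrict_scale scalerDr. Qed.

Fact restrict_scaleDl x : {morph restrict_scale^~ x : t t' / t + t'}.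
Proof. by move=> t t'; rewrite /restrict_scale rmorphD scalerDl. Qed.

Definition restriction : lmodType T :=
  lmodule_of restrict_scaleA restrict_scale1 restrict_scaleDr restrict_scaleDl.

End Restriction.

(** [U] is a direct factor of [T]: [p] is the projection and [j] the embedding
    as the ideal generated by the idempotent [j 1]. *)
Section ChangeOfRings.
Variables (T U : comPzRingType) (p : {rmorphism T -> U}) (j : U -> T).
Implicit Types (M : lmodType T) (N : lmodType U).
Hypothesis pj : forall u, p (j u) = u.
Hypothesis jp : forall t, j (p t) = t * j 1.

Lemma corner_jD u v : j (u + v) = j u + j v.
Proof.
have ju w : j w = j w * j 1 by rewrite -jp pj.
by rewrite (ju u) (ju v) -mulrDl -jp rmorphD !pj.
Qed.

Lemma corner_jM u v : j (u * v) = j u * j v.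
Proof.
have ju w : j w = j w * j 1 by rewrite -jp pj.
by rewrite [in RHS](ju v) mulrA -jp rmorphM !pj.
Qed.

(** [N] is the part of [M] on which the idempotent [j 1] acts as the identity,
    with projection [a] and inclusion [b]. As a relation it covers both
    functors between modules over [T] and over [U]: given [M] it determines [N]
    ([corner_exists]), and given [N] and [inflated M] it determines [M]
    ([inflate_exists]). *)
Definition corner (M : lmodType T) (N : lmodType U) (a : M -> N) (b : N -> M) :
  Prop :=
  [/\ forall t x y, a (t *: x + y) = p t *: a x + a y,
      forall u x y, b (u *: x + y) = j u *: b x + b y,
      forall y, a (b y) = y
    & forall x, b (a x) = j 1 *: x].

Definition inflated (M : lmodType T) : Prop := forall x : M, j 1 *: x = x.

Lemma inflate_exists (N : lmodType U) :
  exists (M : lmodType T) a b, corner (M := M) (N := N) a b /\ inflated M.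
Proof.
pose M := restriction p N.
have inf (x : M) : j 1 *: x = x by rewrite -[LHS]/(p (j 1) *: (x : N)) pj
  scale1r.
exists M, idfun, idfun; split=> //; split=> // u x y.
by rewrite -{1}[u]pj.
Qed.

Lemma corner_exists (M : lmodType T) :
  exists (N : lmodType U) a b, corner (M := M) (N := N) a b.
Proof.
have [|N0 [i [ii iP]]] := @sub_exists T M (fun x => j 1 *: x = x).
  split=> [|t x y ex ey]; first by rewrite scaler0.
  by rewrite scalerDr !scalerA mulrC -scalerA ex ey.
have e1 (x : N0) : j 1 *: x = x.
  by apply: ii; rewrite linearZ /=; apply/iP; exists x.
pose sc u (x : N0) := j u *: x.
have scA t t' x : sc t (sc t' x) = sc (t * t') x.
  by rewrite /sc scalerA corner_jM.
have sc1 : left_id 1 sc by [].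
have scDr : right_distributive sc +%R by move=> t x y; rewrite /sc scalerDr.
have scDl x : {morph sc^~ x : t t' / t + t'}.
  by move=> t t'; rewrite /sc corner_jD scalerDl.
pose N : lmodType U := lmodule_of scA sc1 scDr scDl.
have /choice[a aP] : forall x, exists y, i y = j 1 *: x.
  by move=> x; apply/iP; rewrite scalerA -corner_jM mulr1.
have scE u (x : N) : u *: x = (j u *: (x : N0)) :> N0 by [].
exists N, a, i; split=> [t x y | u x y | y | x //].
- apply: ii; rewrite aP -[(p t *: _ + _)]/(j (p t) *: (a x : N0) + a y).
  rewrite [RHS]linearP !aP jp scalerDr !scalerA; congr (_ *: _ + _).
  by rewrite mulrC -mulrA -corner_jM mulr1.
- by rewrite -[u *: x + y]/(j u *: (x : N0) + y) [LHS]linearP.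
- by apply: ii; rewrite aP; apply/iP; exists y.
Qed.

Section Maps.
Variables (M M' : lmodType T) (N N' : lmodType U).
Variables (a : M -> N) (b : N -> M) (a' : M' -> N') (b' : N' -> M').
Hypotheses (cN : corner a b) (cN' : corner a' b').

Lemma corner_map (f : {linear M -> M'}) :
  exists g : {linear N -> N'},
    (forall x, g (a x) = a' (f x)) /\ (forall y, b' (g y) = f (b y)).
Proof.
have [aP bP ab ba] := cN; have [aP' bP' ab' ba'] := cN'.
have lin : linear (fun y => a' (f (b y))).
  by move=> u x y; rewrite bP linearP aP' pj.
have [g gP] := linear_map_of lin; exists g.
have a1 t x : a' (t *: x) = p t *: a' x.
  have a0 : a' 0 = 0.
    by have := aP' 1 0 0; rewrite rmorph1 !scale1r addr0 =>
      /esym/(canRL (addKr _)) ->; rewrite addNr.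
  by rewrite -[t *: x]addr0 aP' a0 addr0.
split=> [x | y]; rewrite gP; first by rewrite ba linearZ a1 pj scale1r.
by rewrite ba' -linearZ /= -ba ab.
Qed.

Lemma inflate_map (g : {linear N -> N'}) :
  exists f : {linear M -> M'},
    (forall x, a' (f x) = g (a x)) /\ (forall y, f (b y) = b' (g y))
    /\ forall x, f x = b' (g (a x)).
Proof.
have [aP bP ab ba] := cN; have [aP' bP' ab' ba'] := cN'.
have lin : linear (fun x => b' (g (a x))).
  move=> t x y; rewrite aP linearP bP' jp -scalerA; congr (_ *: _ + _).
  by rewrite -ba' ab'.
have [f fP] := linear_map_of lin; exists f.
by split=> [x | ]; [rewrite fP ab' | split=> [y | x]; rewrite fP ?ab].
Qed.

End Maps.

Lemma corner0 M N (a : M -> N) b : corner a b -> a 0 = 0 /\ b 0 = 0.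
Proof.
move=> [aP bP ab ba]; have a0 : a 0 = 0.
  have := aP 1 0 0; rewrite rmorph1 !scale1r addr0.
  by move=> /eqP; rewrite -subr_eq0 opprD addNKr oppr_eq0 => /eqP.
by split=> //; rewrite -{1}a0 ba scaler0.
Qed.

Lemma corner_exact (A B C : lmodType T) (A' B' C' : lmodType U)
    (a1 : A -> A') b1 (a2 : B -> B') b2 (a3 : C -> C') b3
    (f : {linear A -> B}) (g : {linear B -> C})
    (f' : {linear A' -> B'}) (g' : {linear B' -> C'}) :
  corner a1 b1 -> corner a2 b2 -> corner a3 b3 ->
  (forall x, f' (a1 x) = a2 (f x)) -> (forall y, b2 (f' y) = f (b1 y)) ->
  (forall x, g' (a2 x) = a3 (g x)) -> (forall y, b3 (g' y) = g (b2 y)) ->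
  exact_at f g -> exact_at f' g'.
Proof.
move=> c1 c2 c3 fa fb ga gb ex y.
have [aP1 bP1 ab1 ba1] := c1; have [aP2 bP2 ab2 ba2] := c2.
have [aP3 bP3 ab3 ba3] := c3; have [a30 b30] := corner0 c3.
have -> : g' y = 0 <-> g (b2 y) = 0.
  by rewrite -gb; split=> [-> // | h]; rewrite -[LHS]ab3 h.
rewrite ex; split=> [[x xP] | [x <-]]; last by exists (b1 x).
by exists (a1 x); rewrite fa xP ab2.
Qed.

Lemma corner_inj (A B : lmodType T) (A' B' : lmodType U)
    (a1 : A -> A') b1 (a2 : B -> B') b2
    (f : {linear A -> B}) (f' : {linear A' -> B'}) :
  corner a1 b1 -> corner a2 b2 -> (forall y, b2 (f' y) = f (b1 y)) ->
  injective f -> injective f'.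
Proof.
move=> [_ _ ab1 _] c2 fb fi x y fxy; rewrite -[x]ab1 -[y]ab1; congr a1.
by apply: fi; rewrite -!fb fxy.
Qed.

Lemma corner_surj (A B : lmodType T) (A' B' : lmodType U)
    (a1 : A -> A') b1 (a2 : B -> B') b2
    (f : {linear A -> B}) (f' : {linear A' -> B'}) :
  corner a1 b1 -> corner a2 b2 -> (forall x, f' (a1 x) = a2 (f x)) ->
  surj f -> surj f'.
Proof.
move=> _ [_ _ ab2 _] fa fs y; have [x xP] := fs (b2 y).
by exists (a1 x); rewrite fa xP ab2.
Qed.

Lemma corner_ses (A B C : lmodType T) (A' B' C' : lmodType U)
    (a1 : A -> A') b1 (a2 : B -> B') b2 (a3 : C -> C') b3
    (f : {linear A -> B}) (g : {linear B -> C})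
    (f' : {linear A' -> B'}) (g' : {linear B' -> C'}) :
  corner a1 b1 -> corner a2 b2 -> corner a3 b3 ->
  (forall x, f' (a1 x) = a2 (f x)) -> (forall y, b2 (f' y) = f (b1 y)) ->
  (forall x, g' (a2 x) = a3 (g x)) -> (forall y, b3 (g' y) = g (b2 y)) ->
  ses f g -> ses f' g'.
Proof.
move=> c1 c2 c3 fa fb ga gb [fi gs ex]; split.
- exact: corner_inj c1 c2 fb fi.
- exact: corner_surj c2 c3 ga gs.
- exact: corner_exact c1 c2 c3 fa fb ga gb ex.
Qed.

Lemma inflate_ses (A B C : lmodType T) (A' B' C' : lmodType U)
    (a1 : A -> A') b1 (a2 : B -> B') b2 (a3 : C -> C') b3
    (f : {linear A -> B}) (g : {linear B -> C})
    (f' : {linear A' -> B'}) (g' : {linear B' -> C'}) :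
  corner a1 b1 -> corner a2 b2 -> corner a3 b3 ->
  inflated A -> inflated B -> inflated C ->
  (forall x, f x = b2 (f' (a1 x))) -> (forall x, g x = b3 (g' (a2 x))) ->
  ses f' g' -> ses f g.
Proof.
move=> c1 c2 c3 iA iB iC fP gP [fi gs ex].
have [aP1 bP1 ab1 ba1] := c1; have [aP2 bP2 ab2 ba2] := c2.
have [aP3 bP3 ab3 ba3] := c3; have [a30 b30] := corner0 c3.
split=> [x y | y | x].
- rewrite !fP => /(congr1 a2); rewrite !ab2 => /fi/(congr1 b1).
  by rewrite !ba1 !iA.
- have [x xP] := gs (a3 y); exists (b2 x).
  by rewrite gP ab2 xP ba3 iC.
- have -> : g x = 0 <-> g' (a2 x) = 0.
    by rewrite gP; split=> [h | -> //]; rewrite -[LHS]ab3 h.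
  rewrite ex; split=> [[y yP] | [y <-]].
    by exists (b1 y); rewrite fP ab1 yP ba2 iB.
  by exists (a1 y); rewrite fP ab2.
Qed.

(** Cutting out the corner is left adjoint to inflation, which preserves
    surjections. *)
Lemma corner_projective M N (a : M -> N) b : corner a b ->
  projective M -> projective N.
Proof.
move=> c pM A B g f gs; have [aP bP ab ba] := c.
have [MA [aA [bA [cA iA]]]] := inflate_exists A.
have [MB [aB [bB [cB iB]]]] := inflate_exists B.
have [gI [gI1 [gI2 gI3]]] := inflate_map cA cB g.
have [fI [fI1 [fI2 fI3]]] := inflate_map c cB f.
have [_ _ aAb _] := cA; have [_ _ aBb bBa] := cB.
have gIs : surj gI.
  by move=> y; have [x xP] := gs (aB y); exists (bA x); rewrite gI2 xP bBa iB.
have [h hP] := pM _ _ gI fI gIs.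
have [k [k1 k2]] := corner_map c cA h.
exists k => y; rewrite -[y in LHS]ab k1 -gI1 hP fI1 ab //.
Qed.

(** Inflation is left adjoint to cutting out the corner, which preserves
    surjections. *)
Lemma inflate_projective M N (a : M -> N) b : corner a b -> inflated M ->
  projective N -> projective M.
Proof.
move=> c iM pN A B g f gs; have [aP bP ab ba] := c.
have [NA [aA [bA cA]]] := corner_exists A.
have [NB [aB [bB cB]]] := corner_exists B.
have [gC [gC1 gC2]] := corner_map cA cB g.
have [fC [fC1 fC2]] := corner_map c cB f.
have gCs : surj gC by apply: corner_surj cA cB gC1 gs.
have [h hP] := pN _ _ gC fC gCs.
have [k [k1 [k2 k3]]] := inflate_map c cA h.
exists k => x; rewrite k3 -gC2 hP fC2 ba.
by rewrite iM.
Qed.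

(** The extension property follows from the adjunction: a map into [Q] is the
    same as a map into the inflation of [Q], which is projective. *)
Lemma corner_link M M' N N' (a : M -> N) b (a' : M' -> N') b' :
  corner a b -> corner a' b' -> link M M' -> link N N'.
Proof.
move=> c c' [P [i [q [pP ex ext]]]].
have [NP [aP [bP cP]]] := corner_exists P.
have [iC [iC1 iC2]] := corner_map c cP i.
have [qC [qC1 qC2]] := corner_map cP c' q.
exists NP, iC, qC; split; first exact: corner_projective cP pP.
  exact: corner_ses c cP c' iC1 iC2 qC1 qC2 ex.
move=> Q pQ u; have [MQ [aQ [bQ [cQ iQ]]]] := inflate_exists Q.
have [uI [u1 [u2 u3]]] := inflate_map c cQ u.
have [v vP] := ext MQ (inflate_projective cQ iQ pQ) uI.
have [vC [v1 v2]] := corner_map cP cQ v.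
exists vC => y; have [_ _ ab _] := c; rewrite -[y]ab iC1 v1 vP u1 //.
Qed.

Lemma inflate_link M M' N N' (a : M -> N) b (a' : M' -> N') b' :
  corner a b -> corner a' b' -> inflated M -> inflated M' ->
  link N N' -> link M M'.
Proof.
move=> c c' iM iM' [P [i [q [pP ex ext]]]].
have [MP [aP [bP [cP iP]]]] := inflate_exists P.
have [iI [iI1 [iI2 iI3]]] := inflate_map c cP i.
have [qI [qI1 [qI2 qI3]]] := inflate_map cP c' q.
exists MP, iI, qI; split; first exact: inflate_projective cP iP pP.
  exact: inflate_ses c cP c' iM iP iM' iI3 qI3 ex.
move=> Q pQ u; have [NQ [aQ [bQ cQ]]] := corner_exists Q.
have [uC [u1 u2]] := corner_map c cQ u.
have [v vP] := ext NQ (corner_projective cQ pQ) uC.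
have [vI [v1 [v2 v3]]] := inflate_map cP cQ v.
exists vI => x; have [_ _ ab ba] := c.
by rewrite v3 iI1 vP u2 ba iM.
Qed.

Lemma corner_gproj M N (a : M -> N) b : corner a b ->
  gorenstein_projective M -> gorenstein_projective N.
Proof.
move=> c /gprojP[X clX XM]; apply/gprojP.
exists (fun N => exists M a b, X M /\ corner (M := M) (N := N) a b);
  last by exists M, a, b.
move=> {M a b c XM}N [M [a [b [XM c]]]].
have [[M1 XM1 l1] [M2 XM2 l2]] := clX M XM.
have [N1 [a1 [b1 c1]]] := corner_exists M1.
have [N2 [a2 [b2 c2]]] := corner_exists M2.
split; [exists N1 | exists N2]; try by [exists M1, a1, b1 | exists M2, a2, b2].
  exact: corner_link c c1 l1.
exact: corner_link c2 c l2.
Qed.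

Lemma inflate_gproj M N (a : M -> N) b : corner a b -> inflated M ->
  gorenstein_projective N -> gorenstein_projective M.
Proof.
move=> c iM /gprojP[X clX XN]; apply/gprojP.
exists (fun M => exists N a b,
  [/\ X N, corner (M := M) (N := N) a b & inflated M]);
  last by exists N, a, b.
move=> {N a b c XN iM}M [N [a [b [XN c iM]]]].
have [[N1 XN1 l1] [N2 XN2 l2]] := clX N XN.
have [M1 [a1 [b1 [c1 i1]]]] := inflate_exists N1.
have [M2 [a2 [b2 [c2 i2]]]] := inflate_exists N2.
split; [exists M1 | exists M2]; try by [exists N1, a1, b1 | exists N2, a2, b2].
  exact: inflate_link c c1 iM i1 l1.
exact: inflate_link c2 c i2 iM l2.
Qed.

Lemma corner_res M N (a : M -> N) b n : corner a b ->
  has_gproj_resolution M n -> has_gproj_resolution N n.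
Proof.
elim: n M N a b => [|n IH] M N a b c.
  by move=> /res0P gM; apply/res0P; apply: corner_gproj c gM.
move=> /resSP[K [G [i [q [ex gG rK]]]]]; apply/resSP.
have [K' [aK [bK cK]]] := corner_exists K.
have [G' [aG [bG cG]]] := corner_exists G.
have [iC [iC1 iC2]] := corner_map cK cG i.
have [qC [qC1 qC2]] := corner_map cG c q.
exists K', G', iC, qC; split.
- exact: corner_ses cK cG c iC1 iC2 qC1 qC2 ex.
- exact: corner_gproj cG gG.
- exact: IH cK rK.
Qed.

Lemma inflate_res M N (a : M -> N) b n : corner a b -> inflated M ->
  has_gproj_resolution N n -> has_gproj_resolution M n.
Proof.
elim: n M N a b => [|n IH] M N a b c iM.
  by move=> /res0P gN; apply/res0P; apply: inflate_gproj c iM gN.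
move=> /resSP[K [G [i [q [ex gG rK]]]]]; apply/resSP.
have [K' [aK [bK [cK iK]]]] := inflate_exists K.
have [G' [aG [bG [cG iG]]]] := inflate_exists G.
have [iI [_ [_ iI3]]] := inflate_map cK cG i.
have [qI [_ [_ qI3]]] := inflate_map cG c q.
exists K', G', iI, qI; split.
- exact: inflate_ses cK cG c iK iG iM iI3 qI3 ex.
- exact: inflate_gproj cG iG gG.
- exact: IH cK iK rK.
Qed.

Lemma corner_sum M N (a : M -> N) b (I : Type) (r : seq I) (F : I -> M)
    (G : I -> N) :
  corner a b ->
  a (\sum_(k <- r) F k) = \sum_(k <- r) a (F k) /\
  b (\sum_(k <- r) G k) = \sum_(k <- r) b (G k).
Proof.
move=> c; have [aP bP ab ba] := c; have [a0 b0] := corner0 c.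
elim: r => [|k r [IHa IHb]]; first by rewrite !big_nil.
rewrite !big_cons -IHa -IHb -[F k]scale1r aP rmorph1 !scale1r; split=> //.
rewrite -[G k]scale1r bP -ba ab scale1r //.
Qed.

Lemma corner_fg_free M N (a : M -> N) b : corner a b -> fg_free M -> fg_free N.
Proof.
move=> c [n [v vP]]; have [aP bP ab ba] := c; have [a0 b0] := corner0 c.
have aZ t x : a (t *: x) = p t *: a x by rewrite -[t *: x]addr0 aP a0 addr0.
have bZ u x : b (u *: x) = j u *: b x by rewrite -[u *: x]addr0 bP b0 addr0.
exists n, (a \o v) => y; have [w [wP wu]] := vP (b y).
exists (map_mx p w); split=> [|w' w'P].
  rewrite -[LHS]ab wP (corner_sum _ _ (fun=> 0) c).1; apply: eq_bigr => k _.
  by rewrite aZ mxE.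
have -> : w = map_mx j w'.
  apply: wu; rewrite w'P (corner_sum _ (fun=> 0) _ c).2;
    apply: eq_bigr => k _ /=.
  by rewrite mxE bZ ba scalerA -corner_jM mulr1.
by apply/matrixP=> r s; rewrite !mxE pj.
Qed.

Lemma corner_presented n M N (a : M -> N) b : corner a b ->
  n_presented n M -> n_presented n N.
Proof.
move=> c [F [d [eps [fF es e0 e]]]].
have H k : {N : lmodType U & {ab : (F k -> N) * (N -> F k) | corner ab.1 ab.2}}.
  have [N' H1] := cid (corner_exists (F k)); have [a' H2] := cid H1.
  by have [b' H3] := cid H2; exists N', (a', b').
pose F' k := projT1 (H k); pose aF k := (sval (projT2 (H k))).1.
pose bF k := (sval (projT2 (H k))).2.
have cF k : corner (aF k) (bF k) := svalP (projT2 (H k)).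
have D k := cid (corner_map (cF k.+1) (cF k) (d k)).
have [eC [eC1 eC2]] := corner_map (cF 0%N) c eps.
exists F', (fun k => sval (D k)), eC; split.
- by move=> k kn; apply: corner_fg_free (cF k) (fF k kn).
- exact: corner_surj (cF 0%N) c eC1 es.
- move=> n0; have [d1 d2] := svalP (D 0%N).
  exact: corner_exact (cF 1%N) (cF 0%N) c d1 d2 eC1 eC2 (e0 n0).
- move=> k kn; have [d1 d2] := svalP (D k); have [d3 d4] := svalP (D k.+1).
  exact: corner_exact (cF k.+2) (cF k.+1) (cF k) d3 d4 d1 d2 (e k kn).
Qed.

Lemma corner_reg : corner (p : T^o -> U^o) (j : U^o -> T^o).
Proof.
split=> [t x y | u x y | y | x].
- by rewrite rmorphD rmorphM.
- by rewrite corner_jD corner_jM.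
- exact: pj.
- by rewrite jp mulrC.
Qed.

Lemma corner_rV n :
  corner (map_mx p : 'rV[T]_n -> 'rV[U]_n) (map_mx j : 'rV[U]_n -> 'rV[T]_n).
Proof.
split=> [t x y | u x y | y | x]; apply/matrixP=> r s; rewrite !mxE.
- by rewrite rmorphD rmorphM.
- by rewrite corner_jD corner_jM.
- by [].
- by rewrite jp mulrC.
Qed.

End ChangeOfRings.

(** * Finite free and Noetherian modules *)

Section FiniteFree.
Variable R : comPzRingType.
Implicit Types A B C F M N : lmodType R.

Lemma rV_map_exists n M (b : 'I_n -> M) :
  exists h : {linear 'rV[R]_n -> M}, forall c, h c = \sum_i c 0 i *: b i.
Proof.
have lin : linear (fun c : 'rV[R]_n => \sum_i c 0 i *: b i).
  move=> k c d; rewrite scaler_sumr -big_split; apply: eq_bigr => i _ /=.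
  by rewrite !mxE scalerDl scalerA.
by have [h hP] := linear_map_of lin; exists h.
Qed.

Lemma rV_projective n : projective ('rV[R]_n : lmodType R).
Proof.
move=> A B g f gs; have [a aP] := choice (fun i => gs (f (delta_mx 0 i))).
have [h hP] := rV_map_exists a; exists h => c.
rewrite hP linear_sum [in RHS](row_sum_delta c) linear_sum;
  apply: eq_bigr => i _.
by rewrite !linearZ /= aP.
Qed.

Lemma reg_projective : projective (R^o : lmodType R).
Proof.
move=> A B g f gs; have [x xP] := gs (f 1); have [h hP] := line_exists x.
exists h => r; rewrite hP linearZ /= xP -linearZ /=; congr (f _).
exact: mulr1.
Qed.

Lemma fg_free_iso F : fg_free F -> exists n (f : {linear 'rV[R]_n -> F})
  (g : {linear F -> 'rV[R]_n}), (forall x, f (g x) = x) /\ forall c,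
    g (f c) = c.
Proof.
move=> [n [b bP]]; have [f fP] := rV_map_exists b.
have fi : injective f.
  move=> c d cd; have [w [_ wu]] := bP (f c).
  by rewrite -(wu c (fP c)) -(wu d) // cd fP.
have [|g gP] := lift_inj (f := idfun) fi.
  by move=> x; have [w [wP _]] := bP x; exists w; rewrite fP -wP.
by exists n, f, g; split=> // c; apply: fi; rewrite gP.
Qed.

Lemma iso_fg_free n F (f : {linear 'rV[R]_n -> F}) :
  injective f -> surj f -> fg_free F.
Proof.
move=> fi fs; exists n, (fun i => f (delta_mx 0 i)) => x.
have fE c : f c = \sum_i c 0 i *: f (delta_mx 0 i).
  by rewrite {1}(row_sum_delta c) linear_sum; apply: eq_bigr => i _;
    rewrite linearZ.
have [c <-] := fs x; exists c; split=> [|d]; first exact: fE.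
by rewrite -fE => /fi.
Qed.

Lemma rV_fg_free n : fg_free ('rV[R]_n : lmodType R).
Proof. by apply: (@iso_fg_free n _ idfun) => // x; exists x. Qed.

Lemma reg_fg_free : fg_free (R^o : lmodType R).
Proof.
exists 1%N, (fun=> 1) => x; exists (const_mx x); split=> [|c ->].
  by rewrite big_ord1 mxE -[RHS]/(x * 1) mulr1.
rewrite big_ord1; apply/matrixP=> i j; rewrite !mxE !ord1.
by rewrite -[LHS]/(c 0 0 * 1) mulr1.
Qed.

Lemma presented1 F0 F1 M (d : {linear F1 -> F0}) (eps : {linear F0 -> M}) :
  fg_free F0 -> fg_free F1 -> surj eps -> exact_at d eps -> n_presented 1 M.
Proof.
move=> f0 f1 es ex.
pose F k : lmodType R :=
  match k with 0 => F0 | 1 => F1 | _ => 'rV[R]_0 : lmodType R end.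
pose dF k : {linear F k.+1 -> F k} := match k with 0 => d | _ => \0 end.
exists F, dF, eps; split=> //.
by case=> [|[|]].
Qed.

Lemma presented2 F0 F1 F2 M (d' : {linear F2 -> F1}) (d : {linear F1 -> F0})
    (eps : {linear F0 -> M}) :
  fg_free F0 -> fg_free F1 -> fg_free F2 -> surj eps -> exact_at d eps ->
  exact_at d' d -> n_presented 2 M.
Proof.
move=> f0 f1 f2 es ex ex'.
pose F k : lmodType R :=
  match k with 0 => F0 | 1 => F1 | 2 => F2 | _ => 'rV[R]_0 : lmodType R end.
pose dF k : {linear F k.+1 -> F k} :=
  match k with 0 => d | 1 => d' | _ => \0 end.
exists F, dF, eps; split=> //.
  by case=> [|[|[|]]].
by case=> [|[|]].
Qed.

Definition fg_sub M (S : M -> Prop) : Prop :=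
  exists n (f : {linear 'rV[R]_n -> M}), forall x, S x <-> exists c, f c = x.

Definition noetherian_module M : Prop :=
  forall S : M -> Prop, submodule S -> fg_sub S.

Lemma noetherian_reg : noetherian R -> noetherian_module R^o.
Proof.
move=> nR S [S0 SP]; have [|n [g gP]] := nR S.
  split=> [//|x y Sx Sy|a x Sx]; first by have := SP 1 x y Sx Sy;
    rewrite scale1r.
  by have := SP a x 0 Sx S0; rewrite addr0.
have [f fP] := @rV_map_exists n R^o g; exists n, f => x; rewrite gP.
split=> [[c ->] | [c <-]].
  by exists (\row_i c i); rewrite fP; apply: eq_bigr => i _; rewrite mxE.
by exists (fun i => c 0 i); rewrite fP.
Qed.

(** Generators of the intersection with [A], together with lifts of generators
    of the image in [C]. *)
Lemma noetherian_ext A B C (i : {linear A -> B}) (q : {linear B -> C}) :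
  ses i q -> noetherian_module A -> noetherian_module C -> noetherian_module B.
Proof.
move=> [ii qs ex] nA nC S sS.
have [|n [f fP]] := nA (fun x => S (i x)).
  by split=> [|a x y Sx Sy]; rewrite ?linear0 ?linearP;
    [case: sS | apply: sS.2].
have [|m [g gP]] := nC (fun y => exists2 x, S x & q x = y).
  split=> [|a _ _ [x Sx <-] [y Sy <-]].
    by exists 0; [case: sS | rewrite linear0].
  by exists (a *: x + y); [apply: sS.2 | rewrite linearP].
have Sg c : exists2 x, S x & q x = g c by apply/gP; exists c.
have /choice[b bP] : forall k, exists x, S x /\ q x = g (delta_mx 0 k).
  by move=> k; have [x Sx xP] := Sg (delta_mx 0 k); exists x.
have [h hP] := rV_map_exists b.
have hS c : S (h c).
  rewrite hP; elim/big_ind: _ => [|x y Sx Sy|k _]; first by case: sS.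
    by rewrite -[x]scale1r; apply: sS.2.
  by rewrite -[_ *: _]addr0; apply: sS.2; [case: (bP k) | case: sS].
have qh c : q (h c) = g c.
  rewrite hP [in RHS](row_sum_delta c) !linear_sum; apply: eq_bigr => k _.
  by rewrite !linearZ (bP k).2.
have lin : linear (fun c : 'rV[R]_(n + m) => i (f (lsubmx c)) + h (rsubmx c)).
  by move=> a c d; rewrite !linearP /= scalerDr addrACA.
have [l lP] := linear_map_of lin; exists (n + m)%N, l => x.
have Sf c : S (i (f c)) by apply/fP; exists c.
split=> [Sx | [c <-]]; last first.
  by rewrite lP -[i _]scale1r; apply: sS.2.
have /gP[d dP] : exists2 x', S x' & q x' = q x by exists x.
have /ex[y yP] : q (x - h d) = 0 by rewrite linearB /= qh dP subrr.
have /fP[c cP] : S (i y).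
  rewrite yP addrC -scaleN1r; exact: sS.2.
by exists (row_mx c d); rewrite lP row_mxKl row_mxKr cP yP subrK.
Qed.

Lemma noetherian_rV n : noetherian R -> noetherian_module 'rV[R]_n.
Proof.
move=> nR; elim: n => [|n IH].
  move=> S [S0 _]; exists 0%N, idfun => x; rewrite (rV0_zero x).
  by split=> // _; exists 0.
have lini : linear (fun c : 'rV[R]_n => row_mx 0 c : 'rV[R]_(1 + n)).
  by move=> a c d; rewrite scale_row_mx add_row_mx scaler0 addr0.
have linq : linear (fun c : 'rV[R]_(1 + n) => c 0 0 : R^o).
  by move=> a c d; rewrite !mxE.
have [i iP] := linear_map_of lini; have [q qP] := linear_map_of linq.
apply: (noetherian_ext (i := i) (q := q)) IH (noetherian_reg nR).
split=> [c d | y | c].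
- by rewrite !iP => /(congr1 rsubmx); rewrite !row_mxKr.
- by exists (const_mx y); rewrite qP mxE.
- rewrite qP; split=> [c0 | [d <-]].
    exists (rsubmx (c : 'rV_(1 + n))); rewrite iP -[RHS]hsubmxK; congr row_mx.
    by apply/matrixP=> k l; rewrite !ord1 !mxE -[LHS]c0; congr (c _ _);
      apply: val_inj.
  rewrite iP; have -> : 0 = lshift n 0 :> 'I_(1 + n) by apply: val_inj.
  by rewrite row_mxEl mxE.
Qed.

End FiniteFree.

(** * Vector spaces *)

Section FieldSpaces.
Variables (K : fieldType) (E : lmodType K).

(** A linear relation between the generators of a vector space allows one of
    them to be dropped. *)
Lemma span_fg_free m (f : {linear 'rV[K]_m -> E}) : surj f -> fg_free E.
Proof.
move: m f; suff H m : forall f : {linear 'rV[K]_m -> E}, surj f ->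
  fg_free E by exact: H.
elim: m => [|m IH] f fs.
  by apply: iso_fg_free fs => x y _; rewrite (rV0_zero x) (rV0_zero y).
have [fi | ] := pselect (injective f); first exact: iso_fg_free fs.
move=> /(contra_not (@linear_injP _ _ _ f))/existsNP[c] /not_implyP[fc /eqP c0].
have /rV0Pn[i ci] := c0.
have [h hP] := rV_map_exists (fun k : 'I_m => f (delta_mx 0 (lift i k))).
apply: (IH h) => x; have [v <-] := fs x.
(* The relation [c] removes the [i]-th coordinate. *)
pose w := v - (v 0 i / c 0 i) *: c.
have -> : f v = f w by rewrite linearB linearZ /= fc scaler0 subr0.
have w0 : w 0 i = 0 by rewrite !mxE divfK ?subrr.
exists (\row_k w 0 (lift i k)); rewrite hP [in RHS](row_sum_delta w) linear_sum.
rewrite (bigD1_ord i) //= linearZ /= w0 scale0r add0r.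
by apply: eq_bigr => k _; rewrite linearZ mxE.
Qed.

Lemma infinite_dim_not_line e : infinite_dim E -> ~ forall x : E, exists k : K,
  x = k *: e.
Proof.
move=> infE all; apply: infE; have [h hP] := rV_map_exists (fun _ : 'I_1 => e).
apply: (span_fg_free (f := h)) => x; have [k ->] := all x.
by exists (const_mx k); rewrite hP big_ord1 mxE.
Qed.

Lemma infinite_dim_nonzero : infinite_dim E -> exists e : E, e <> 0.
Proof.
move=> infE; apply: contrapT => /forallNP all.
apply: (infinite_dim_not_line (e := 0) infE) => x.
by exists 0; rewrite scaler0; apply: contrapT; apply: all.
Qed.

(** A submodule maximal among those that avoid [e] is a complement of the line
    spanned by [e]; the functional is the projection along it. *)
Lemma functional_exists (e : E) : e <> 0 ->
  exists f : {linear E -> K^o}, f e = 1.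
Proof.
move=> e0; pose PT (A : E -> Prop) := submodule A /\ ~ A e;
  pose T := {A | PT A}.
pose Rel (A B : T) : bool := `[< forall x, sval A x -> sval B x >].
have [//|A B C /asboolP AB /asboolP BC|S tot|[A [sA nA]] /= Amax] :=
    ZL_preorder (exist PT _ (conj (zero_submodule E) e0)) (R := Rel).
- by move=> A; apply/asboolP.
- by apply/asboolP=> x /AB/BC.
- have [[A SA] | S0] := pselect (exists A, S A); last first.
    exists (exist PT _ (conj (zero_submodule E) e0)) => B SB.
    by case: S0; exists B.
  have sub : submodule (fun x => exists2 B : T, S B & sval B x)
      /\ ~ exists2 B : T, S B & sval B e.
    split; last by move=> [B _ Be]; case: (svalP B) => _; apply.
    split=> [|a x y [B SB Bx] [C SC Cy]].
      by exists A => //; case: (svalP A) => -[].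
    have [/asboolP h | /asboolP h] := tot B C SB SC.
      by exists C => //; apply: (svalP C).1.2 => //; apply: h.
    by exists B => //; apply: (svalP B).1.2 => //; apply: h.
  exists (exist PT _ sub) => B SB; apply/asboolP => x Bx.
  by exists B.
have AN x : A x -> A (- x).
  by move=> Ax; rewrite -[- x]addr0 -scaleN1r; apply: sA.2 => //; case: (sA).
have AD x y : A x -> A y -> A (x + y).
  by move=> Ax; rewrite -[x]scale1r; apply: sA.2.
have AZ k x : A x -> A (k *: x).
  by move=> Ax; rewrite -[_ *: _]addr0; apply: sA.2 => //; case: (sA).
have ex x : exists k : K^o, A (x - k *: e).
  have sB : submodule (fun y => exists r a, A a /\ y = a + r *: x).
    split=> [|a _ _ [r [b [Ab ->]]] [r' [b' [Ab' ->]]]].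
      by exists 0, 0; rewrite scale0r addr0; split=> //; case: (sA).
    exists (a * r + r'), (a *: b + b'); split; first exact: sA.2.
    by rewrite scalerDr scalerDl scalerA addrACA.
  have [[r [a [Aa er]]] | nB] := pselect (exists r a, A a /\ e = a + r *: x).
    have r0 : r != 0.
      by apply/eqP=> r0; apply: (nA); rewrite er r0 scale0r addr0.
    exists r^-1; rewrite er scalerDr scalerA mulVf // scale1r opprD addrCA subrr
      addr0.
    exact/AN/AZ.
  have /Amax/asboolP/= BA : Rel (exist PT A (conj sA nA))
    (exist PT _ (conj sB nB)).
    by apply/asboolP=> y /= Ay; exists 0, y; rewrite scale0r addr0.
  exists 0; rewrite scale0r subr0; apply: BA; exists 1, 0.
  by rewrite scale1r add0r; split=> //; case: (sA).
have uniq (k l : K^o) x : A (x - k *: e) -> A (x - l *: e) -> k = l.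
  move=> Ak Al; apply/eqP/negP => /negP kl; apply: (nA).
  have /(AZ (l - k)^-1) : A ((l - k) *: e).
    rewrite scalerBl; have := AD _ _ Ak (AN _ Al).
    by rewrite opprB addrC addrA subrK.
  by rewrite scalerA mulVf ?scale1r // subr_eq0 eq_sym.
have /choice[f fP] := ex.
have lin : linear f.
  move=> a x y; apply: uniq (fP _) _.
  have -> : a *: x + y - (a *: f x + f y) *: e = a *:
    (x - f x *: e) + (y - f y *: e).
    by rewrite scalerBr scalerDl opprD addrACA -scalerA.
  by apply: AD; first exact: AZ.
have [g gP] := linear_map_of lin; exists g; rewrite gP.
by apply: uniq (fP e) _; rewrite scale1r subrr; case: (sA).
Qed.

End FieldSpaces.

(** * The trivial extension of a field by an infinite-dimensional space *)

Section TrivialExtension.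
Variables (K : fieldType) (E : lmodType K).
Local Notation R := (trivext E).

(** The residue map, and the residue field as a subring. *)
Definition tfst (r : R) : K := r.1.
Definition tin (k : K) : R := (k, 0).

Fact tfst_zmod : zmod_morphism tfst. Proof. by []. Qed.
Fact tfst_monoid : monoid_morphism tfst. Proof. by split. Qed.
HB.instance Definition _ := GRing.isZmodMorphism.Build R K tfst tfst_zmod.
HB.instance Definition _ := GRing.isMonoidMorphism.Build R K tfst tfst_monoid.

Fact tin_zmod : zmod_morphism tin.
Proof. by move=> k l; congr (_, _); rewrite /= subr0. Qed.
Fact tin_monoid : monoid_morphism tin.
Proof. by split=> // k l; congr (_, _); rewrite /= !scaler0 addr0. Qed.
HB.instance Definition _ := GRing.isZmodMorphism.Build K R tin tin_zmod.
HB.instance Definition _ := GRing.isMonoidMorphism.Build K R tin tin_monoid.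

Definition teps (x : E) : R := (0, x).

Lemma mul_teps (r : R) x : r * teps x = teps (tfst r *: x).
Proof.
by rewrite -[LHS]/(_, _) /= mulr0 scale0r addr0.
Qed.

Lemma teps_mul0 (r s : R) : tfst r = 0 -> tfst s = 0 -> r * s = 0.
Proof.
move=> r0 s0; rewrite -[LHS]/(r.1 * s.1, r.1 *: s.2 + s.1 *: r.2).
by rewrite -[r.1]/(tfst r) -[s.1]/(tfst s) r0 s0 mul0r !scale0r addr0.
Qed.

Lemma tepsE (r : R) : tfst r = 0 -> r = teps r.2.
Proof. by case: r => a x; rewrite /tfst /= => ->. Qed.

Hypothesis infE : infinite_dim E.

(** [E] is the syzygy of the residue field [k] and has [k] as a retract, so the
    vanishing in degree [n.+1] implies that in degree [n]. In the lowest
    degree, the map [x |-> f x *: e] from [E] to [R] would extend to [R], so it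
    would be a scalar multiplication, and [E] would be a line. *)
Lemma residue_ext_nonzero n : ~ ext_van (R^o : lmodType R) n
  (restriction tfst (K^o : lmodType K)).
Proof.
set k := restriction _ _; pose V := restriction tfst E.
have [e e0] := infinite_dim_nonzero infE.
have [f fe] := functional_exists e0.
have linj : linear (teps : V -> R^o).
  move=> r x y; congr (_, _); rewrite /= ?mulr0 ?addr0 //.
  by rewrite scale0r addr0.
have [j jP] := linear_map_of linj.
have linq : linear (tfst : R^o -> k) by [].
have [q qP] := linear_map_of linq.
have ex : ses j q.
  split=> [x y | y | r]; first by rewrite !jP => -[].
    by exists (tin y); rewrite qP.
  by rewrite qP; split=> [/tepsE -> | [x <-]];
    [exists r.2; rewrite jP | rewrite jP].
have lina : linear (fun c : k => (c : K) *: e : V).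
  by move=> r x y; rewrite -[LHS]/((tfst r * (x : K) + (y : K)) *: e) scalerDl
    -scalerA.
have [a aP] := linear_map_of lina.
have linr : linear (f : V -> k).
  by move=> r x y; rewrite -[r *: x + y]/(tfst r *: (x : E) + (y : E)) linearP.
have [r rP] := linear_map_of linr.
have ra c : r (a c) = c.
  rewrite rP aP linearZ /= fe; exact: mulr1.
elim: n => [X0 | n IH /(_ _ _ j q (@reg_projective _) ex) XV]; last first.
  by apply: IH; apply: (ext_van_retract (a := a) (r := r)) XV.
have linu : linear (fun x : V => teps (f (x : E) *: e) : R^o).
  move=> s x y; rewrite -[s *: x + y]/(tfst s *: (x : E) + (y : E)) linearP.
  congr (_, _); rewrite /= ?mulr0 ?addr0 //.
  by rewrite scale0r addr0 scalerDl scalerA.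
have [u uP] := linear_map_of linu.
have [v vP] := X0 _ _ j q ex u.
have fx x : f x *: e = tfst (v 1) *: x.
  have := vP x; rewrite uP jP => vx.
  have : v (teps x) = teps x * v 1 by rewrite -linearZ /=; congr (v _);
    rewrite -[RHS]/(teps x * 1) mulr1.
  by rewrite vx mulrC mul_teps => -[].
have /eqP : (tfst (v 1) - 1) *: e = 0 by rewrite scalerBl -fx fe subrr.
rewrite scaler_eq0 subr_eq0 (introF eqP e0) orbF => /eqP v1.
apply: (infinite_dim_not_line (e := e) infE) => x; exists (f x).
by rewrite fx v1 scale1r.
Qed.

(** The kernel of [p] is a line, that is, a copy of the residue field. *)
Lemma cyclic_quotient_no_res e (B : lmodType R) (p : {linear R^o -> B}) n :
  e <> 0 -> surj p -> (forall r, p r = 0 <-> exists s, r = s * teps e) ->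
  ~ has_gproj_resolution B n.
Proof.
move=> e0 ps pK rB; pose k := restriction tfst (K^o : lmodType K).
have linj : linear (fun c : k => teps ((c : K) *: e) : R^o).
  move=> r x y; rewrite -[(r *: x + y)]/(tfst r * (x : K) + (y : K)).
  congr (_, _); rewrite /= ?mulr0 ?addr0 //.
  by rewrite scale0r addr0 scalerDl scalerA.
have [j jP] := linear_map_of linj.
have ex : ses j p.
  split=> // [x y | r].
    rewrite !jP => -[] /eqP; rewrite -subr_eq0 -scalerBl scaler_eq0 subr_eq0.
    by case/orP=> /eqP.
  rewrite pK; split=> [[s ->] | [c <-]].
    by exists (tfst s); rewrite jP mul_teps.
  by exists (tin c); rewrite jP mul_teps.
apply: (@residue_ext_nonzero n).
have := res_ext_van rB (@reg_projective R) (leqnSn n).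
by move=> /(_ _ _ j p (@reg_projective _) ex).
Qed.

Section Matrices.
Variables (n0 n1 n2 : nat) (A : 'M[R]_(n1, n0)) (B : 'M[R]_(n2, n1)).
Hypothesis exAB : forall v : 'rV_n1, v *m A = 0 <-> exists w, v = w *m B.

(** Matrices with entries in the maximal ideal. *)
Definition maximal_mx m n (X : 'M[R]_(m, n)) := map_mx tfst X = 0.

Lemma maximal_mx_mul m n q (X : 'M[R]_(m, n)) (Y : 'M[R]_(n, q)) :
  maximal_mx X -> maximal_mx Y -> X *m Y = 0.
Proof.
move=> X0 Y0; apply/matrixP=> r s; rewrite !mxE big1 // => t _.
by apply: teps_mul0; [have /matrixP/(_ r t) := X0 | have /matrixP/(_ t s) := Y0];
  rewrite !mxE.
Qed.

Lemma maximal_mx_mull m n q (X : 'M[R]_(m, n)) (Y : 'M[R]_(n, q)) :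
  maximal_mx Y -> maximal_mx (X *m Y).
Proof. by move=> Y0; rewrite /maximal_mx map_mxM Y0 mulmx0. Qed.

Lemma maximal_mx_mulr m n q (X : 'M[R]_(m, n)) (Y : 'M[R]_(n, q)) :
  maximal_mx X -> maximal_mx (X *m Y).
Proof. by move=> X0; rewrite /maximal_mx map_mxM X0 mul0mx. Qed.

Lemma tin_split m n (X : 'M[R]_(m, n)) :
  exists2 Y, maximal_mx Y & X = map_mx tin (map_mx tfst X) + Y.
Proof.
exists (X - map_mx tin (map_mx tfst X)); last by rewrite addrC subrK.
by rewrite /maximal_mx map_mxB -[map_mx tfst (map_mx tin _)]map_mx_comp
  map_mx_id // subrr.
Qed.

(** Write [A = A0 + A1] with [A0] over [K] and [A1] over the maximal ideal. If
    [G0] is a generalized inverse of [A0], then [G0 - G0 *m A1 *m G0] is one of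
    [A] provided that [(1 - A0 *m G0) *m A1 *m (1 - G0 *m A0) = 0]. *)
Lemma generalized_inverse : exists G, A *m G *m A = A.
Proof.
have [A1 nA AE] := tin_split A; have [B1 nB BE] := tin_split B.
set a := map_mx tfst A in AE; set b := map_mx tfst B in BE.
pose g := pinvmx a; have aga : a *m g *m a = a by apply: mulmxKpV.
pose x := 1%:M - a *m g; pose y := 1%:M - g *m a.
have xa : x *m a = 0 by rewrite mulmxBl mul1mx aga subrr.
have ay : a *m y = 0 by rewrite mulmxBr mulmx1 mulmxA aga subrr.
suff key : map_mx tin x *m A1 *m map_mx tin y = 0.
  pose G0 := map_mx tin g; pose A0 := map_mx tin a.
  have AGA0 : A0 *m G0 *m A0 = A0 by rewrite -!map_mxM aga.
  have A1A1 : A1 *m G0 *m A1 = 0 by apply: maximal_mx_mul;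
    first exact: maximal_mx_mulr.
  have xE : map_mx tin x = 1%:M - A0 *m G0 by rewrite map_mxB map_mx1 map_mxM.
  have yE : map_mx tin y = 1%:M - G0 *m A0 by rewrite map_mxB map_mx1 map_mxM.
  have {}key : A1 = A0 *m G0 *m A1 + A1 *m G0 *m A0 - A0 *m G0 *m A1 *m G0 *m A0.
    apply/eqP; rewrite -subr_eq0 -key xE yE mulmxBr mulmx1 mulmxBl mul1mx.
    by rewrite mulmxBl !mulmxA -addrA opprD addrA.
  have S0 : A0 *m G0 *m A1 *m G0 *m A1 = 0.
    by rewrite -!mulmxA (mulmxA A1) A1A1 !mulmx0.
  pose S := A0 *m G0 *m A1 *m G0.
  have AG : A *m (G0 - G0 *m A1 *m G0) = A0 *m G0 + A1 *m G0 - S.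
    by rewrite AE mulmxBr !mulmxDl -/A0 !mulmxA A1A1 mul0mx addr0.
  have GA0 : (A0 *m G0 + A1 *m G0 - S) *m A0 = A0 + A1 *m G0 *m A0 - S *m A0.
    by rewrite mulmxBl mulmxDl AGA0.
  have GA1 : (A0 *m G0 + A1 *m G0 - S) *m A1 = A0 *m G0 *m A1.
    by rewrite mulmxBl mulmxDl A1A1 S0 addr0 subr0.
  exists (G0 - G0 *m A1 *m G0); rewrite AG AE -/A0 mulmxDr GA0 GA1.
  have reord (V : zmodType) (q r s t : V) : q + r - s + t = q + (t + r - s).
    by rewrite -!addrA [r + (_ + _)]addrA [_ + t]addrC.
  by rewrite reord -key.
apply/row_matrixP => i; rewrite row0 !row_mul -map_row.
set xi := row i x; have xia : xi *m a = 0 by rewrite -row_mul xa row0.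
(* If [xi = w *m b], then [w *m B] is a kernel vector of [A] over [xi], and its
   existence says that [xi *m A1] is a combination of the rows of [a] with
   coefficients in [E]; these rows vanish on [y]. *)
have [/submxP[w wb] | nsub] := boolP (xi <= b)%MS.
  pose v := map_mx tin w *m B.
  have vA : v *m A = 0 by apply/exAB; exists (map_mx tin w).
  have [v1 nv vE] := tin_split v.
  have v0 : map_mx tfst v = xi.
    by rewrite map_mxM -map_mx_comp map_mx_id // -wb.
  rewrite v0 in vE; move: vA; rewrite vE AE mulmxDl !mulmxDr -map_mxM xia.
  rewrite map_mx0 add0r (maximal_mx_mul nv nA) addr0 =>
    /(congr1 (mulmx^~ (map_mx tin y))).
  rewrite mulmxDl -[v1 *m _ *m _]mulmxA -map_mxM ay map_mx0 mulmx0 addr0 mul0mx.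
  by [].
(* Otherwise a column of [cokermx b] separates [xi] from the row space of [b].
   For every [z] in [E] the vector [z xi] is in the kernel of [A], so it is of
   the form [w *m B]; multiplying by that column expresses [z] through finitely
   many vectors, the entries of a column of [B1 *m cokermx b]. *)
have [k xk] : exists k, (xi *m cokermx b) 0 k != 0.
  by apply/rV0Pn; apply: contra nsub => /eqP c0; rewrite submxE c0.
case: infE; have [h hP] := rV_map_exists
  (fun t => ((xi *m cokermx b) 0 k)^-1 *:
    ((B1 *m map_mx tin (cokermx b)) t k).2).
apply: (span_fg_free (f := h)) => z.
have /exAB[w wP] : (teps z *: map_mx tin xi) *m A = 0.
  rewrite AE mulmxDr -!scalemxAl -map_mxM xia map_mx0 scaler0 add0r.
  apply/matrixP=> s t; rewrite !mxE; apply: teps_mul0 => //.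
  have /matrixP/(_ s t) := maximal_mx_mull (map_mx tin xi) nA.
  by rewrite !mxE.
have := congr1 (fun X => (X *m map_mx tin (cokermx b)) 0 k) wP.
rewrite BE -scalemxAl -map_mxM -mulmxA mulmxDl -map_mxM mulmx_coker map_mx0
  add0r.
rewrite [LHS]mxE mulrC [X in X * _]mxE mul_teps => /(congr1 snd) /= zE.
set C := B1 *m _ in hP zE *.
have nC : maximal_mx C by apply: maximal_mx_mulr.
have wC : ((w *m C) 0 k).2 = \sum_t tfst (w 0 t) *: (C t k).2.
  rewrite mxE (big_morph (fun r : R => r.2) (id1 := 0) (op1 := +%R)) //.
  apply: eq_bigr => t _; have C0 : tfst (C t k) = 0.
    by have /matrixP/(_ t k) := nC; rewrite !mxE.
  by rewrite (tepsE C0) mul_teps.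
exists (map_mx tfst w); rewrite hP.
have -> : z = ((xi *m cokermx b) 0 k)^-1 *: ((xi *m cokermx b) 0 k *: z).
  by rewrite scalerA mulVf ?scale1r.
rewrite zE wC scaler_sumr; apply: eq_bigr => t _.
by rewrite mxE !scalerA mulrC.
Qed.

End Matrices.

(** A generalized inverse of the matrix of relations makes the module of
    relations a direct summand, hence splits the presentation. *)
Lemma presented2_projective (M : lmodType R) : n_presented 2 M -> projective M.
Proof.
case=> F [d [eps [fF es e0 e]]].
have [n0 [f0 [g0 [fg0 gf0]]]] := fg_free_iso (fF 0%N isT).
have [n1 [f1 [g1 [fg1 gf1]]]] := fg_free_iso (fF 1%N isT).
have [n2 [f2 [g2 [fg2 gf2]]]] := fg_free_iso (fF 2%N isT).
pose A := lin1_mx (g0 \o d 0%N \o f1); pose B := lin1_mx (g1 \o d 1%N \o f2).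
have AE v : v *m A = g0 (d 0%N (f1 v)) by rewrite mul_rV_lin1.
have BE v : v *m B = g1 (d 1%N (f2 v)) by rewrite mul_rV_lin1.
have [v|G AGA] := @generalized_inverse n0 n1 n2 A B.
  have -> : v *m A = 0 <-> d 0%N (f1 v) = 0.
    rewrite AE; split=> [h | ->]; last by rewrite linear0.
    by rewrite -[LHS]fg0 h linear0.
  rewrite (e 0%N isT); split=> [[x xP] | [w ->]].
    by exists (g2 x); rewrite BE fg2 xP gf1.
  by exists (f2 w); rewrite BE fg1.
have lin : linear (fun v : 'rV_n0 => v - v *m G *m A).
  by move=> a x y; rewrite !mulmxDl -!scalemxAl scalerBr opprD addrACA.
have [s sP] := linear_map_of lin.
have [||t tP] := factor_surj (p := eps \o f0) (f := s).
- by move=> m; have [x <-] := es m; exists (g0 x); rewrite /= fg0.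
- move=> v /= /(e0 isT)[x xP].
  have -> : v = g1 x *m A by rewrite AE fg1 xP gf0.
  by rewrite sP -!mulmxA !(mulmxA A) AGA subrr.
apply: (proj_retract (a := t) (r := eps \o f0)); last exact: rV_projective.
move=> m; have [x <-] := es m; have := tP (g0 x); rewrite /= fg0 => ->.
rewrite sP !linearB /= fg0 -[RHS]subr0; congr (_ - _).
by apply/(e0 isT); rewrite AE; exists (f1 (g0 x *m G)); rewrite fg0.
Qed.

End TrivialExtension.

Lemma infinite_Gpd_module (K : fieldType) (E : lmodType K) : infinite_dim E ->
  exists (e : trivext E) (B : lmodType (trivext E))
      (f : {linear (trivext E)^o -> B}),
  [/\ surj f, forall r, f r = 0 <-> exists s, r = s * e
    & forall n, ~ has_gproj_resolution B n].
Proof.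
move=> infE; have [e e0] := infinite_dim_nonzero infE.
have [|B [f [fs fK]]] := @quot_exists _ (trivext E)^o
  (fun r => exists s, r = s * teps e).
  split=> [|a _ _ [s ->] [t ->]]; first by exists 0; rewrite mul0r.
  by exists (a * s + t); rewrite mulrDl -mulrA.
exists (teps e), B, f; split=> // n.
exact (cyclic_quotient_no_res infE e0 fs fK).
Qed.

(** * Modules over a product of two rings *)

Section ResolutionSums.
Variable R : comPzRingType.
Implicit Types A B M : lmodType R.

Lemma res_iso M M' (f : {linear M -> M'}) n : injective f -> surj f ->
  has_gproj_resolution M' n -> has_gproj_resolution M n.
Proof.
move=> fi fs; case: n => [|n].
  by move=> /res0P gM; apply/res0P; apply: gproj_iso fi fs gM.
have [|g gP] := lift_inj (f := idfun) fi; first exact: fs.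
move=> /resSP[N [G [i [p [[ii ps e] gG rN]]]]]; apply/resSP.
exists N, G, i, (g \o p); split=> //; split=> // [x | x].
  have [y yP] := ps (f x); exists y; apply: fi.
  by rewrite /= gP yP.
rewrite -e /=; split=> [g0 | ->]; last exact: linear0.
by rewrite -[LHS]gP g0 linear0.
Qed.

Lemma res_sum A B n : has_gproj_resolution A n -> has_gproj_resolution B n ->
  has_gproj_resolution (A * B)%type n.
Proof.
elim: n A B => [|n IH] A B.
  by move=> /res0P gA /res0P gB; apply/res0P/gproj_sum.
move=> /resSP[N [G [i [p [ex gG rN]]]]] /resSP[N' [G' [i' [p' [ex' gG' rN']]]]].
have [h hP] := prod_map_exists i i'; have [q qP] := prod_map_exists p p'.
apply/resSP; exists (N * N')%type, (G * G')%type, h, q; split.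
- exact: ses_sum ex ex' hP qP.
- exact: gproj_sum.
- exact: IH.
Qed.

End ResolutionSums.

Section ProductRing.
Variables R S : comPzRingType.
Local Notation T := (R * S)%type.

Definition in1 (r : R) : T := (r, 0).
Definition in2 (s : S) : T := (0, s).
Local Notation p1 := (fst : {rmorphism T -> R}).
Local Notation p2 := (snd : {rmorphism T -> S}).

Lemma p1in1 r : p1 (in1 r) = r. Proof. by []. Qed.
Lemma p2in2 s : p2 (in2 s) = s. Proof. by []. Qed.
Lemma in1p1 t : in1 (p1 t) = t * in1 1.
Proof. by congr (_, _); rewrite /= ?mulr1 ?mulr0. Qed.
Lemma in2p2 t : in2 (p2 t) = t * in2 1.
Proof. by congr (_, _); rewrite /= ?mulr1 ?mulr0. Qed.

Local Notation corner1 := (corner p1 in1).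
Local Notation corner2 := (corner p2 in2).
Local Notation inflated1 := (inflated in1).
Local Notation inflated2 := (inflated in2).

Implicit Types M : lmodType T.

Lemma in1_in2_sum M (x : M) : in1 1 *: x + in2 1 *: x = x.
Proof.
rewrite -scalerDl; have -> : in1 1 + in2 1 = 1 :> T.
  by congr (_, _); rewrite /= ?addr0 ?add0r.
exact: scale1r.
Qed.

Lemma in1_in2_ann M (x : M) : in1 1 *: (in2 1 *: x) = 0 /\ in2 1 *:
  (in1 1 *: x) = 0.
Proof.
rewrite !scalerA; have -> : in1 1 * in2 1 = 0 :> T by congr (_, _);
  rewrite /= ?mulr0 ?mul0r.
have -> : in2 1 * in1 1 = 0 :> T by congr (_, _); rewrite /= ?mulr0 ?mul0r.
by rewrite scale0r.
Qed.

Lemma product_res M (N1 : lmodType R) (N2 : lmodType S) a1 b1 a2 b2 n :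
  corner1 (M := M) (N := N1) a1 b1 -> corner2 (M := M) (N := N2) a2 b2 ->
  has_gproj_resolution N1 n -> has_gproj_resolution N2 n ->
  has_gproj_resolution M n.
Proof.
move=> c1 c2 r1 r2.
have [M1 [x1 [y1 [d1 i1]]]] := inflate_exists p1in1 N1.
have [M2 [x2 [y2 [d2 i2]]]] := inflate_exists p2in2 N2.
have [f1 [_ [_ f1E]]] := inflate_map in1p1 c1 d1 idfun.
have [f2 [_ [_ f2E]]] := inflate_map in2p2 c2 d2 idfun.
have [f fE] := copair_map_exists f1 f2.
have [_ _ ab1 ba1] := c1; have [_ _ ab2 ba2] := c2.
have [_ _ xy1 yx1] := d1; have [_ _ xy2 yx2] := d2.
have [a10 b10] := corner0 c1; have [a20 b20] := corner0 c2.
have [x10 y10] := corner0 d1; have [x20 y20] := corner0 d2.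
have aD1 x y : a1 (x + y) = a1 x + a1 y.
  by have [aP _ _ _] := c1; rewrite -[x in LHS]scale1r aP rmorph1 scale1r.
have aD2 x y : a2 (x + y) = a2 x + a2 y.
  by have [aP _ _ _] := c2; rewrite -[x in LHS]scale1r aP rmorph1 scale1r.
have a12 z : a1 (b2 z) = 0.
  by rewrite -[LHS]ab1 ba1 -[z]ab2 ba2 (in1_in2_ann _).1.
have a21 z : a2 (b1 z) = 0.
  by rewrite -[LHS]ab2 ba2 -[z]ab1 ba1 (in1_in2_ann _).2.
apply: (res_iso (f := f)).
- apply: linear_injP => x; rewrite fE f1E f2E /= => -[y1x y2x].
  rewrite -[x]in1_in2_sum -ba1 -ba2 -[a1 x]xy1 -[a2 x]xy2 y1x y2x x10 x20 b10
    b20.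
  exact: addr0.
- move=> [m1 m2]; exists (b1 (x1 m1) + b2 (x2 m2)).
  rewrite fE f1E f2E /= aD1 aD2 a12 a21 ab1 ab2 addr0 add0r yx1 yx2.
  by rewrite i1 i2.
- apply: res_sum; [exact: inflate_res in1p1 _ _ _ _ _ d1 i1 r1 |].
  exact: inflate_res in2p2 _ _ _ _ _ d2 i2 r2.
Qed.

(** Over the product ring, [B] is the quotient of the ring by the single
    element [(e, 1)]. *)
Lemma product_presented1 (e : R) (B : lmodType R) (f : {linear R^o -> B}) :
  surj f -> (forall r, f r = 0 <-> exists s, r = s * e) ->
  exists (M : lmodType T) a b, corner1 (M := M) (N := B) a b /\ n_presented 1 M.
Proof.
move=> fs fK; have [M [a [b [c iM]]]] := inflate_exists p1in1 B.
have cT := corner_reg p1in1 in1p1.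
have [eps [_ [_ epsE]]] := inflate_map in1p1 cT c f.
have [d dP] := @line_exists T T^o (e, 1).
have [_ _ ab ba] := c; have [a0 b0] := corner0 c.
exists M, a, b; split=> //.
apply: (presented1 (@reg_fg_free T) (@reg_fg_free T) (d := d) (eps := eps)).
  move=> m; have [r rP] := fs (a m); exists (in1 r).
  by rewrite epsE /= rP ba iM.
move=> t; have -> : eps t = 0 <-> f t.1 = 0.
  by rewrite epsE /=; split=> [h | -> //]; rewrite -[LHS]ab h.
rewrite fK; split=> [[s tE] | [s <-]]; last by exists s.1; rewrite dP.
exists (s, t.2); rewrite dP [RHS]surjective_pairing tE.
by congr (_, _); exact: mulr1.
Qed.

(** [M] is [R * C] with [C] inflated: taking all of [R] in degree 0 leaves the
    relations of [C] in the second factor only, and these lift to the product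
    ring. The generators of the next syzygy are those of [S], together with the
    first factor of the free module, which is why the third free module has
    rank [n + m]. *)
Lemma product_presented2 (C : lmodType S) (f : {linear S^o -> C}) :
  noetherian S -> surj f ->
  exists (M : lmodType T) a b, corner2 (M := M) (N := C) a b /\ n_presented 2 M.
Proof.
move=> nS fs.
have [M1 [x1 [y1 [d1 i1]]]] := inflate_exists p1in1 R^o.
have [M2 [x2 [y2 [d2 i2]]]] := inflate_exists p2in2 C.
have cT1 := corner_reg p1in1 in1p1; have cT2 := corner_reg p2in2 in2p2.
have [e1 [_ [_ e1E]]] := inflate_map in1p1 cT1 d1 idfun.
have [e2 [_ [_ e2E]]] := inflate_map in2p2 cT2 d2 f.
have [eps epsE] := copair_map_exists e1 e2.
have [_ _ xy1 yx1] := d1; have [_ _ xy2 yx2] := d2.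
have [x10 y10] := corner0 d1; have [x20 y20] := corner0 d2.
have kerS (A B : lmodType S) (h : {linear A -> B}) :
  submodule (fun x => h x = 0).
  by split=> [|a x y hx hy]; rewrite ?linear0 // linearP hx hy scaler0 addr0.
have [n [g gP]] := noetherian_reg nS (kerS _ _ f).
have [m [h hP]] := noetherian_rV (n := n) nS (kerS _ _ g).
have cn := corner_rV p2in2 in2p2 n; have cm := corner_rV p2in2 in2p2 m.
have [dg [_ [_ dgE]]] := inflate_map in2p2 cn cT2 g.
have [dh [dh1 [dh2 dhE]]] := inflate_map in2p2 cm cn h.
have lin : linear (fun w : 'rV[T]_(n + m) => in1 1 *: lsubmx w + dh (rsubmx w)).
  move=> a x y; rewrite [lsubmx _]linearP [rsubmx _]linearP [dh _]linearP /=.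
  rewrite [in1 1 *: (_ + _)]scalerDr [a *: (_ + _)]scalerDr addrACA.
  by rewrite !scalerA [in1 1 * a]mulrC.
have [k kE] := linear_map_of lin.
exists (M1 * M2)%type, (x2 \o snd), (fun c => (0, y2 c)); split.
  have [xP yP _ _] := d2; split=> [t u v | u c c' | c | [u v]] /=.
  - exact: xP.
  - by rewrite yP; congr (_, _); rewrite /= scaler0 addr0.
  - exact: xy2.
  - by rewrite yx2; congr (_, _); rewrite /= -[u]i1 (in1_in2_ann _).2.
apply: (presented2 (@reg_fg_free T) (@rV_fg_free T n) (@rV_fg_free T (n + m))
  (eps := eps) (d := dg) (d' := k)).
- move=> [m1 m2]; have [s sP] := fs (x2 m2); exists (x1 m1, s).
  by rewrite epsE e1E e2E /= sP yx1 yx2 i1 i2.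
- move=> t; split=> [| [v <-]]; last first.
    rewrite epsE e1E e2E dgE /= [f _](gP _).2 ?y20 ?y10 //.
    by exists (map_mx p2 v).
  rewrite epsE e1E e2E /= => -[y1t y2t].
  have t1 : t.1 = 0 by rewrite -[LHS]xy1 y1t x10.
  have /gP[c cP] : f t.2 = 0 by rewrite -[LHS]xy2 y2t x20.
  exists (map_mx in2 c); rewrite dgE [RHS]surjective_pairing t1 -cP.
  by congr (_, g _); apply/matrixP=> r s; rewrite !mxE.
- have [_ _ mK mE] := cn; move=> v.
  have -> : dg v = 0 <-> g (map_mx p2 v) = 0.
    by rewrite dgE; split=> [/(congr1 p2) | ->].
  rewrite hP; split=> [[c cP] | [w <-]].
    exists (row_mx v (map_mx in2 c)); rewrite kE row_mxKl row_mxKr dh2 cP mE.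
    exact: in1_in2_sum.
  exists (map_mx p2 (rsubmx w)); rewrite kE -dh1.
  have [aP _ _ _] := cn; rewrite aP.
  by rewrite scale0r add0r.
Qed.

End ProductRing.

(** * The Gorenstein global dimension is attained on cyclic modules *)

Lemma Ggldim_res (S : comPzRingType) d M : Ggldim S = Some d ->
  @has_gproj_resolution S M d.
Proof. by move=> /least_SomeP[h _]; apply/Gpd_leP. Qed.

(** The hypothesis on cyclic modules bounds Ext into projectives for all
    modules, and finite Gorenstein dimension turns this bound into
    resolutions. *)
Lemma Ggldim_cyclic (S : comPzRingType) d n : Ggldim S = Some d ->
  (forall (C : lmodType S) (f : {linear S^o -> C}), surj f ->
    has_gproj_resolution C n) ->
  (d <= n)%N.
Proof.
move=> gl cyc; have /least_SomeP[_] := gl; apply=> M; apply/Gpd_leP.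
apply: ext_van_res => [N gN | Q k pQ nk].
  exact: proj_orth_gproj (Ggldim_res N gl) gN.
by apply: cyclic_ext_van => C f fs; apply: res_ext_van (cyc C f fs) pQ nk.
Qed.

Local Close Scope ring_scope.

Theorem theorem3p1 (K : fieldType) (E : lmodType K) (infE : infinite_dim E) :
  [/\ G_ring 2 0 (trivext E),
      forall d : nat, 0 < d -> ~ G_ring 1 d (trivext E)
    & forall (S : comPzRingType) (d : nat), noetherian S -> Ggldim S = Some d ->
        [/\ G_ring 2 d (trivext E * S)%type,
            ~ G_ring 1 d (trivext E * S)%type
          & 1 <= d -> ~ G_ring 2 (d - 1) (trivext E * S)%type]].
Proof.
have [e [B [f [fs fK noB]]]] := infinite_Gpd_module infE.
split=> [M pM | d _ gR | S d nS gl].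
- by apply/Gpd_leP/res0P/proj_gproj; apply: presented2_projective infE M pM.
- apply: (noB d); apply/Gpd_leP/gR.
  have [d0 d0P] := line_exists (e : (trivext E)^o).
  apply: (presented1 (@reg_fg_free _) (@reg_fg_free _) (d := d0) fs) => r.
  by rewrite fK; split=> [[s ->] | [s <-]]; exists s; rewrite d0P.
split=> [M pM | gT | d1 gT].
- apply/Gpd_leP.
  have [N1 [a1 [b1 c1]]] := corner_exists (@p1in1 _ _) (@in1p1 (trivext E) S) M.
  have [N2 [a2 [b2 c2]]] := corner_exists (@p2in2 _ _) (@in2p2 (trivext E) S) M.
  apply: product_res (c1) c2 _ (Ggldim_res N2 gl).
  apply: res_leq (leq0n d) _; apply/res0P/proj_gproj.
  apply: (presented2_projective infE).
  exact: (corner_presented (@p1in1 _ _) (@in1p1 (trivext E) S) c1 pM).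
- have [M [a [b [c pM]]]] := product_presented1 S fs fK.
  apply: (noB d); apply: (corner_res (@p1in1 _ _) (@in1p1 (trivext E) S) c).
  exact/Gpd_leP/gT.
- suff : d <= d - 1 by rewrite leq_subRL // ltnn.
  apply: Ggldim_cyclic gl _ => C g gs.
  have [M [a [b [c pM]]]] := product_presented2 (trivext E) nS gs.
  apply: (corner_res (@p2in2 _ _) (@in2p2 (trivext E) S) c).
  exact/Gpd_leP/gT.
Qed.
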